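(* The deviation $K(b,0)-b\log(b)$ admits, as $b\to\infty$ ($b\ge2$ an integer), an asymptotic expansion in inverse powers of $b$ to all orders. There holds: \begin{align*} K(b,0)&=b\log(b)+b\log\Gamma\Bigl(1+\frac1b\Bigr)-\psi(1)-\frac{\zeta(2)}{2b(b^2-b+1)}+\frac{5\zeta(3)}{6b^5}+O(b^{-6})\\ &=b\log(b)+\frac{\zeta(2)}{2b}-\frac{\zeta(3)}{3b^2}-\frac{2\zeta(2)-\zeta(4)}{4b^3}-\frac{5\zeta(2)/2+\zeta(5)}{5b^4}+\frac{5\zeta(3)+\zeta(6)}{6b^5}+O(b^{-6}). \end{align*}
   Context: For an integer $b\ge2$, $K(b,0)=\sum'\frac1m$ is the (convergent) sum over all integers $m>0$ whose base-$b$ representation (without leading zeros) does not contain the digit $0$. $\Gamma$ is the Gamma function, $\psi=\Gamma'/\Gamma$ the digamma function, $\zeta$ the Riemann zeta function. A function $f$ of the integer $b$ has an asymptotic expansion to all orders in inverse powers of $b$ if there are coefficients $a_n$ independent of $b$ such that for every $N$, $f(b)=\sum_{n\le N}a_nb^{-n}+O(b^{-N-1})$ as $b\to\infty$. *)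

(* Defs.v *)
(* MathComp-Analysis. *)
From mathcomp Require Import all_boot all_order all_algebra.
From mathcomp Require Import all_classical all_reals all_analysis.
Set Implicit Arguments.
Unset Strict Implicit.
Unset Printing Implicit Defensive.
Import Order.TTheory GRing.Theory Num.Theory.
Import numFieldNormedType.Exports.
Local Open Scope classical_set_scope.
Local Open Scope ring_scope.

(* Least significant digit first.  For b >= 2 and m > 0, trunc_log b m is the
   exponent of the leading digit, so there are no leading zeros; no meaning is
   attached to the value outside that range. *)
Definition digits (b m : nat) : seq nat :=
  [seq ((m %/ b ^ k) %% b)%N | k <- iota 0 (trunc_log b m).+1].

(* K(b, d): the numbers m > 0 with no base-b digit equal to d; needs b >= 2. *)
Definition K {R : realType} (b d : nat) : R :=
  \big[+%R/0]_(1 <= m <oo | d \notin digits b m) (m%:R^-1 : R).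

(* Euler's integral; meaningful for x > 0. *)
Definition Gamma {R : realType} (x : R) : R :=
  \int[lebesgue_measure]_(t in `]0%R, +oo[) (t `^ (x - 1) * expR (- t)).

Definition digamma {R : realType} (x : R) : R := derive1 Gamma x / Gamma x.

(* Dirichlet series; meaningful for real s > 1, the only range needed here. *)
Definition zeta {R : realType} (s : R) : R :=
  \big[+%R/0]_(1 <= n <oo) (n%:R : R) `^ (- s).

(* f(b) = g(b) + O(b^-N) as b -> +oo *)
Definition eq_upto_inv_pow {R : realType} (N : nat) (f g : nat -> R) : Prop :=
  f = g +O_\oo (fun b : nat => b%:R ^- N : R).

Definition asymptotic_expansion_inv {R : realType} (f a : nat -> R) : Prop :=
  forall N : nat,
    eq_upto_inv_pow N.+1 f (fun b => \sum_(n < N.+1) a n * b%:R ^- n).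

(* Main.v *)
Require Import Defs.
From mathcomp Require Import all_boot all_order all_algebra.
From mathcomp Require Import all_classical all_reals all_analysis.
From mathcomp Require Import measurable_realfun ring lra.
Import Order.TTheory GRing.Theory Num.Theory.
Import numFieldNormedType.Exports.
Local Open Scope classical_set_scope.
Local Open Scope ring_scope.
Set Implicit Arguments.
Unset Strict Implicit.
Unset Printing Implicit Defensive.

(** The sum over zero-free integers is governed by a positive functional.  For
    a function f on [0, 1] put Tf(x) = (1/b) sum_(1 <= d < b) f((d + x)/b).
    Then T^l f(0) is b^-l times the sum of f(X/b^l) over the strings X of l
    nonzero digits, and mu(f) = sum_l T^l f(0) is an integral against a measure
    of total mass b which satisfies mu(f) = f(0) + mu(Tf).  Splitting a
    zero-free integer into its leading digit n and the string of the remaining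
    digits gives K(b, 0) = mu(g) with g(x) = sum_(1 <= n < b) 1/(n + x)
    ([K_partial_exp], [cvg_K]).

    Let h(x) = sum_(n >= 1) (1/n - 1/(n + x)), which is psi(1 + x) - psi(1).
    Gauss's multiplication formula for psi says exactly that
    Th(x) = h(x) + g(x) - ln b - h(x/b)/b ([transfer_harm]).  Applying mu and
    h(0) = 0 makes mu(h) cancel, and leaves
    K(b, 0) = b ln b + (1/b) mu(h(x/b)).  The Taylor expansion
    h(y) = zeta(2) y - zeta(3) y^2 + ... then gives, with the normalized moments
    v_k = mu(x^k)/b in [0, 1],
    K(b, 0) = b ln b + zeta(2) v_1/b - zeta(3) v_2/b^2 + ...
    with an explicit error after each number of terms ([K_expansion]).

    The functional equation applied to x^k expresses v_k linearly through
    v_0 = 1, ..., v_k with coefficients b^-j S_p(b)/b^(p+1), where S_p(b) is the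
    sum of the p-th powers below b ([mom_rec_scaled]).  By induction S_p(b)/b^(p+1)
    and v_k admit expansions in 1/b to all orders ([expandable_scaled_sum],
    [expandable_mom]), hence so does K(b, 0) - b ln b.  Solving the
    recurrence gives v_1, ..., v_5 to the precision needed for the second
    explicit formula.

    The first explicit formula differs from the second one by the expansion
    ln Gamma(1 + x) = - gamma x + zeta(2) x^2/2 - zeta(3) x^3/3 + ... at x = 1/b
    and by psi(1) = - gamma.  Both come from Euler's product for Gamma, which
    holds for the integral because of Gamma(s + 1) = s Gamma(s)
    ([eGamma_succ]) and of the bound Gamma(s + x) <= s^x Gamma(s) for
    0 <= x <= 1 ([eGamma_addr_le]); the latter integrates the inequality
    between the concave function t^x and its tangent at t = s. *)

(** * Limits of sequences *)

Lemma cvg_invn2 (R : realType) : (fun n : nat => n.+2%:R^-1 : R) @ \oo --> (0 : R).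
Proof.
have := @cvg_harmonic R; rewrite -(cvg_shiftn 1); under eq_fun do rewrite addn1.
by [].
Qed.

Lemma cvg_sumr (R : realType) (I : Type) (r : seq I) (u : I -> nat -> R) (l : I -> R) :
  (forall i, u i @ \oo --> l i) ->
  (fun n => \sum_(i <- r) u i n) @ \oo --> \sum_(i <- r) l i.
Proof.
move=> ul; elim: r => [|i r IH].
  by under eq_fun do rewrite big_nil; rewrite big_nil; exact: cvg_cst.
by under eq_fun do rewrite big_cons; rewrite big_cons; apply: cvgD.
Qed.

Lemma cvg_norm_le (R : realType) (u v : nat -> R) (l c : R) :
  u @ \oo --> l -> v @ \oo --> c -> (forall n, `|u n| <= v n) -> `|l| <= c.
Proof.
move=> ul vc uv; apply: (ler_cvg_to (cvg_norm ul) vc); exact: nearW.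
Qed.

Lemma cvg_subseq (R : realType) (u : nat -> R) (l : R) (f : nat -> nat) :
  (forall n, (n <= f n)%N) -> u @ \oo --> l -> (u \o f) @ \oo --> l.
Proof.
move=> nf /cvgrPdist_le ul; apply/cvgrPdist_le => e /ul [N _ NP].
by exists N => // n /= Nn; apply: NP; exact: leq_trans (nf n).
Qed.

(** * Zeta values, Euler's constant and the Taylor expansion of the logarithm *)

Section Zeta.
Variable R : realType.
Implicit Types (x u : R) (n K : nat).

(** Partial sums of the Dirichlet series of zeta(j). *)
Definition zetap n j : R := \sum_(k < n) k.+1%:R ^- j.

Lemma zetap_le2 n j : (2 <= j)%N -> zetap n j <= 2.
Proof.
move=> j2; suff : zetap n.+1 j <= 2 - n.+1%:R^-1.
  move=> h; apply: (@le_trans _ _ (zetap n.+1 j)).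
    by rewrite /zetap big_ord_recr/= lerDl invr_ge0 exprn_ge0.
  by rewrite (le_trans h)// gerBl.
elim: n => [|n IH]; first by rewrite /zetap big_ord_recr big_ord0/= expr1n invr1; lra.
rewrite /zetap big_ord_recr/= -/(zetap n.+1 j).
have a0 : (0 : R) < n.+1%:R by rewrite ltr0n.
have b0 : (0 : R) < n.+2%:R by rewrite ltr0n.
(* Comparison with the telescoping series of 1/(n + 1) - 1/(n + 2). *)
have h : (n.+2%:R : R) ^- j <= n.+1%:R^-1 - n.+2%:R^-1.
  apply: (@le_trans _ _ (n.+2%:R ^- 2)).
    by rewrite lef_pV2 ?posrE ?exprn_gt0// ler_eXn2l// ltr1n.
  rewrite -subr_ge0.
  have -> : n.+1%:R^-1 - n.+2%:R^-1 - n.+2%:R ^- 2 = (n.+1%:R * n.+2%:R ^+ 2)^-1 :> R.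
    by rewrite -[n.+2%:R]natr1 in b0 *; field; rewrite !gt_eqF.
  by rewrite invr_ge0 mulr_ge0// exprn_ge0.
by have := lerD IH h; rewrite addrA subrK.
Qed.

Lemma cvg_zetap j : (2 <= j)%N -> zetap ^~ j @ \oo --> zeta (j%:R : R).
Proof.
move=> j2.
have cv : cvgn (zetap ^~ j).
  apply: nondecreasing_is_cvgn.
    apply/nondecreasing_seqP => n.
    by rewrite /zetap big_ord_recr/= lerDl invr_ge0 exprn_ge0.
  by exists 2 => _ [n _ <-]; exact: zetap_le2.
suff -> : zeta (j%:R : R) = lim (zetap ^~ j @ \oo) by [].
apply/cvg_lim => //; rewrite -cvg_shiftS/=.
rewrite (_ : (fun n => _) = zetap ^~ j)//.
apply/funext => n; rewrite big_add1/= big_mkord.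
by apply: eq_bigr => i _; rewrite powR_invn.
Qed.

(** The sequence sum_(1 <= k <= n) 1/k - ln (n + 1), written as a series with
    nonnegative terms. *)
Definition euler_seq n : R := \sum_(k < n) (k.+1%:R^-1 - ln (k.+2%:R / k.+1%:R)).

Lemma euler_seqE n : euler_seq n = \sum_(k < n) k.+1%:R^-1 - ln n.+1%:R.
Proof.
elim: n => [|n IH]; first by rewrite /euler_seq !big_ord0 ln1 subr0.
rewrite /euler_seq !big_ord_recr/= -/(euler_seq n) IH ln_div ?posrE ?ltr0n//; ring.
Qed.

(** The Euler-Mascheroni constant. *)
Definition euler_gamma : R := lim (euler_seq @ \oo).

Lemma cvg_euler_seq : euler_seq @ \oo --> euler_gamma.
Proof.
have e k : ln (k.+2%:R / k.+1%:R) = ln (1 + k.+1%:R^-1) :> R.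
  by congr ln; rewrite -[k.+2%:R]natr1 mulrDl divff ?mul1r// pnatr_eq0.
apply: nondecreasing_is_cvgn.
  apply/nondecreasing_seqP => n.
  rewrite /euler_seq big_ord_recr/= lerDl subr_ge0 e le_ln1Dx//.
  by rewrite (lt_le_trans (ltrN10 _)).
exists 1 => _ [n _ <-].
suff : euler_seq n <= 1 - n.+1%:R^-1 by move=> h; rewrite (le_trans h)// gerBl.
elim: n => [|n IH]; first by rewrite /euler_seq big_ord0 invr1 subrr.
rewrite /euler_seq big_ord_recr/= -/(euler_seq n).
(* ln (1 + 1/(n + 1)) >= 1/(n + 2) makes the partial sums telescope. *)
have h : - ln (n.+2%:R / n.+1%:R) <= - (n.+2%:R^-1 : R).
  rewrite -lnV ?posrE ?divr_gt0//.
  have -> : (n.+2%:R / n.+1%:R)^-1 = 1 + (- n.+2%:R^-1) :> R.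
    by rewrite invf_div -[X in X / _ = _](addrK 1) natr1 mulrDl divff ?pnatr_eq0// mulN1r.
  by rewrite le_ln1Dx// ltrN2 invf_lt1// ltr1n.
by rewrite addrA (le_trans (lerD (lerD IH (lexx _)) h))// subrK.
Qed.

(** By the mean value theorem: the derivative of the left-hand side is
    u (- u)^K/(1 + u). *)
Lemma ln1p_taylor u K : `|u| <= 2^-1 ->
  `|u - ln (1 + u) - \sum_(j < K) (-1) ^+ j * u ^+ j.+2 / j.+2%:R| <= 2 * `|u| ^+ K.+2.
Proof.
pose P k (v : R) : R := \sum_(j < k) (-1) ^+ j * v ^+ j.+2 / j.+2%:R.
pose dP k (v : R) : R := v * \sum_(j < k) (- v) ^+ j.
have derP k (v : R) : is_derive v (1 : R) (P k) (dP k v).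
  elim: k => [|k IH].
    rewrite /dP big_ord0 mulr0 (_ : P 0 = cst 0).
      exact: is_derive_cst.
    by apply/funext => w; rewrite /P big_ord0.
  rewrite /dP big_ord_recr/= mulrDr.
  rewrite (_ : P k.+1 = P k + ((-1) ^+ k / k.+2%:R) *: (id ^+ k.+2 : R -> R)); last first.
    by apply/funext => w; rewrite /P big_ord_recr/= mulrAC exprfctE.
  have h := is_deriveD IH (is_deriveZ ((-1) ^+ k / k.+2%:R)
    (is_deriveX k.+2 (is_derive_id v (1 : R)))).
  apply: (is_derive_eq h); congr (_ + _).
  rewrite /GRing.scale/= mulr1 mulrA divfK ?pnatr_eq0//.
  by rewrite exprS mulrCA -exprMn mulN1r.
pose F (v : R) : R := v - ln (1 + v) - P K v.
pose dF (v : R) : R := 1 - (1 + v)^-1 - dP K v.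
have dFE (v : R) : 0 < 1 + v -> dF v = v * (- v) ^+ K / (1 + v).
  move=> v0; have e : (1 + v) * dP K v = v * (1 - (- v) ^+ K).
    by rewrite mulrCA; congr (_ * _); rewrite -opprB subrX1 -mulNr opprB opprK.
  apply: (mulfI (lt0r_neq0 v0)).
  rewrite /dF mulrBr e mulrC [RHS]mulrC divfK ?gt_eqF//.
  by rewrite mulrBl mulVf ?gt_eqF//; ring.
move=> u2; rewrite -/(P K u) -/(F u).
have F0 : F 0 = 0.
  rewrite /F addr0 ln1 subrr sub0r /P big1 ?oppr0// => j _.
  by rewrite expr0n mulr0 mul0r.
have derF (v : R) : -1 < v -> is_derive v 1 F (dF v).
  move=> v1.
  have v10 : 0 < 1 + v by lra.
  have h1 : is_derive v 1 (fun w : R => ln (1 + w)) (1 + v)^-1.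
    have h2 : is_derive v 1 (fun w : R => 1 + w) (0 + 1 : R).
      exact: is_deriveD (is_derive_cst _ _ _) (is_derive_id _ _).
    have := @is_derive1_comp R (@ln R) (fun w : R => 1 + w) v _ _ (is_derive1_ln v10) h2.
    by rewrite add0r mulr1.
  by apply: is_deriveB; exact: derP.
have bound (c : R) : `|c| <= `|u| -> `|dF c| <= 2 * `|u| ^+ K.+1.
  move=> cu; have c2 : `|c| <= 2^-1 by exact: le_trans u2.
  have c1 : 2^-1 <= 1 + c by move: c2; rewrite ler_norml; lra.
  have c10 : 0 < 1 + c by lra.
  rewrite dFE// normrM normfV normrM normrX normrN -exprS mulrC.
  rewrite (gtr0_norm c10) ler_pM ?invr_ge0 ?(ltW c10) ?exprn_ge0//.
    by rewrite invf_ple ?posrE.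
  by rewrite lerXn2r ?nnegrE.
have cF (v : R) : -1 < v -> {for v, continuous F}.
  by move=> /derF [h _]; apply: differentiable_continuous; exact/derivable1_diffP.
have key : exists2 c, `|c| <= `|u| & F u = dF c * u.
  have := u2; rewrite ler_norml => /andP[ul ur].
  have [u0|u0] := leP 0 u.
    have [c| |c] := @MVT_segment R F dF 0 u u0.
    - by rewrite in_itv/= => /andP[c0 cu]; apply: derF; lra.
    - apply: continuous_in_subspaceT => c; rewrite inE/= in_itv/= => /andP[c0 cu].
      by apply: cF; lra.
    - rewrite in_itv/= F0 !subr0 => /andP[c0 cu] ->; exists c => //.
      by rewrite !ger0_norm.
  have [c| |c] := @MVT_segment R F dF u 0 (ltW u0).
  - by rewrite in_itv/= => /andP[c0 cu]; apply: derF; lra.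
  - apply: continuous_in_subspaceT => c; rewrite inE/= in_itv/= => /andP[c0 cu].
    by apply: cF; lra.
  - rewrite in_itv/= F0 !sub0r => /andP[c0 cu] e; exists c => //.
      by rewrite !ler0_norm ?lerN2// ltW.
    by apply: oppr_inj; rewrite e mulrN.
have [c cu ->] := key.
by rewrite normrM exprSr mulrA ler_wpM2r// bound.
Qed.

End Zeta.

(** * The Gamma integral *)

(** The concave function u^x lies below its tangent at u = 1. *)
Lemma powR_le_tangent1 (R : realType) (x u : R) :
  0 <= x <= 1 -> 0 < u -> u `^ x <= 1 - x + x * u.
Proof.
move=> /andP[x0 x1] u0; set c := 1 - x + x * u.
have c0 : 0 < c by rewrite /c; nra.
rewrite /powR gt_eqF// -[leRHS]lnK ?posrE// ler_expR.
(* The inequality ln z <= z - 1 at z = u/c and z = 1/c, with weights x and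
   1 - x: the right-hand sides cancel. *)
have h1 : ln u - ln c <= u / c - 1.
  rewrite -ln_div ?posrE// -[leLHS]/(ln (u / c)).
  have -> : u / c = 1 + (u / c - 1) by lra.
  by rewrite (le_trans (le_ln1Dx _))// ?ltrBrDl ?subrr ?divr_gt0//; lra.
have h2 : - ln c <= c^-1 - 1.
  rewrite -lnV ?posrE//.
  have -> : c^-1 = 1 + (c^-1 - 1) by lra.
  by rewrite (le_trans (le_ln1Dx _))// ?ltrBrDl ?subrr ?invr_gt0//; lra.
have e : x * (u / c - 1) + (1 - x) * (c^-1 - 1) = 0.
  by rewrite /c; field; rewrite -/c gt_eqF.
have := ler_wpM2l x0 h1; have x1' : 0 <= 1 - x by lra.
by have := ler_wpM2l x1' h2; lra.
Qed.

(** Euler's integral with values in the extended reals: no integrability is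
    needed to state its properties, and finiteness comes out of them. *)
Definition eGamma (R : realType) (s : R) : \bar R :=
  (\int[lebesgue_measure]_(t in `]0%R, +oo[) (t `^ (s - 1) * expR (- t))%:E)%E.

Lemma Gamma_fine (R : realType) (s : R) : Gamma s = fine (eGamma s).
Proof. by []. Qed.

Lemma eGamma_ge0 (R : realType) (s : R) : (0 <= eGamma s)%E.
Proof.
by apply: integral_ge0 => t _; rewrite lee_fin mulr_ge0 ?powR_ge0 ?expR_ge0.
Qed.

Lemma measurable_Gamma_integrand (R : realType) (s : R) (D : set R) :
  measurable D ->
  measurable_fun D (EFin \o (fun t : R => t `^ s * expR (- t))).
Proof.
move=> mD; apply/measurable_EFinP; apply: measurable_funM.
  exact: measurableT_comp (measurable_powR _) _.
exact: measurableT_comp (@measurable_expR _) _.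
Qed.

Lemma powR_derivable_oo (R : realType) (s a b : R) : 0 < a -> a < b ->
  derivable_oo_LRcontinuous (fun t : R => t `^ s) a b.
Proof.
move=> a0 ab.
have d (x : R) : 0 < x -> derivable (fun t : R => t `^ s) x 1.
  by move=> x0; apply: derivable_powR; rewrite in_itv/= andbT.
have c (x : R) : 0 < x -> {for x, continuous (fun t : R => t `^ s)}.
  by move=> x0; apply: differentiable_continuous; exact/derivable1_diffP/d.
split.
- by move=> x; rewrite in_itv/= => /andP[ax _]; apply: d; exact: lt_trans ax.
- exact: cvg_at_right_filter (c _ a0).
- by apply: cvg_at_left_filter (c _ _); exact: lt_trans ab.
Qed.

Lemma is_derive_expRN (R : realType) (t : R) :
  is_derive t 1 (fun t => - expR (- t)) (expR (- t)).
Proof.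
have h : is_derive t 1 (fun u => expR (- u)) (- 1 * expR (- t)).
  by have := is_derive1_comp (f := expR) (g := -%R) (x := t); rewrite mulrC; apply.
by apply: is_derive_eq (is_deriveN h) _; rewrite mulN1r opprK.
Qed.

Lemma integral_Gamma_by_parts (R : realType) (s a b : R) : 0 < a -> a < b ->
  (\int[lebesgue_measure]_(t in `[a, b]) (t `^ s * expR (- t))%:E =
  (a `^ s * expR (- a) - b `^ s * expR (- b))%:E +
  s%:E * \int[lebesgue_measure]_(t in `[a, b]) (t `^ (s - 1) * expR (- t))%:E)%E.
Proof.
move=> a0 ab.
have posab x : x \in `[a, b] -> 0 < x.
  by rewrite in_itv/= => /andP[ax _]; exact: lt_le_trans ax.
have ce : continuous (fun t : R => expR (- t)).
  by move=> x; apply: continuous_comp; [exact: opp_continuous|exact: continuous_expR].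
have cp z : {within `[a, b], continuous (fun t : R => t `^ z)}.
  by apply: derivable_oo_LRcontinuous_within; exact: powR_derivable_oo.
rewrite (@integration_by_parts R (fun t => t `^ s) (fun t => - expR (- t))
  (fun t => s * t `^ (s - 1)) (fun t => expR (- t)))//.
- rewrite !mulrN opprK [X in X%:E]addrC; congr (_ + _)%E.
  under eq_integral do rewrite mulrN -2!mulNr -mulrA EFinM.
  rewrite integralZl//=; first by rewrite EFinN mulNe oppeK.
  apply: continuous_compact_integrable; first exact: segment_compact.
  apply/subspace_continuousP => x xab; apply: cvgM; last exact: cvg_within_filter (ce x).
  by move: (cp (s - 1)) => /subspace_continuousP; exact.
- apply/subspace_continuousP => x xab; apply: cvgM; first exact: cvg_cst.
  by move: (cp (s - 1)) => /subspace_continuousP; exact.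
- exact: powR_derivable_oo.
- move=> x; rewrite in_itv/= => /andP[ax _].
  by rewrite powR_derive1// in_itv/= andbT (lt_trans a0 ax).
- by apply: continuous_subspaceT.
- split.
  + by move=> x _; apply: ex_derive; exact: is_derive_expRN.
  + by apply: cvg_at_right_filter; apply: cvgN; exact: ce.
  + by apply: cvg_at_left_filter; apply: cvgN; exact: ce.
- by move=> x _; rewrite derive1E; apply: derive_val; exact: is_derive_expRN.
Qed.

Lemma cvg_powRM_expRN (R : realType) (s : R) :
  (fun n : nat => n%:R `^ s * expR (- n%:R) : R) @ \oo --> (0 : R).
Proof.
have [m sm] : exists m : nat, s <= m%:R.
  by exists (Num.truncn `|s|).+1; apply: le_trans (ler_norm _) (ltW (truncnS_gt _)).
(* n^m e^-n <= (m + 1)!/n, from the term of degree m + 1 of e^n. *)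
have h : (fun n : nat => m.+1`!%:R * n.+1%:R^-1 : R) @ \oo --> (0 : R).
  rewrite -[X in _ --> X](mulr0 (m.+1`!%:R)).
  by apply: cvgM; [exact: cvg_cst|exact: cvg_harmonic].
rewrite -cvg_shiftS /=.
apply: (squeeze_cvgr _ (cvg_cst 0) h).
apply: nearW => n /=; rewrite mulr_ge0 ?powR_ge0 ?expR_ge0//=.
have n0 : (0 : R) < n.+1%:R by rewrite ltr0n.
rewrite expRN ler_pdivrMr ?expR_gt0//.
apply: (@le_trans _ _ (n.+1%:R ^+ m)).
  by rewrite -powR_mulrn// ler_powR// ler1n.
rewrite mulrAC ler_pdivlMr//.
rewrite -exprSr mulrC -ler_pdivrMr ?ltr0n ?fact_gt0//.
by apply: le_trans (expR_ge1Dxn m (ltW n0)); rewrite lerDr.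
Qed.

Lemma bigcup_itv_invn_n (R : realType) :
  \bigcup_n `[n.+2%:R^-1, n.+2%:R]%classic = `]0, +oo[%classic :> set R.
Proof.
apply/seteqP; split => x/=.
  move=> [n _]/=; rewrite !in_itv/= andbT => /andP[+ _].
  by apply: lt_le_trans; rewrite invr_gt0.
rewrite in_itv/= andbT => x0.
exists (Num.truncn (Num.max x x^-1)) => //=.
set m := Num.max _ _; rewrite in_itv/=.
have mx : m <= (Num.truncn m).+2%:R.
  by rewrite (le_trans (ltW (truncnS_gt m)))// ler_nat.
apply/andP; split; last by rewrite (le_trans _ mx)// le_max lexx.
rewrite -[leRHS]invrK lef_pV2 ?posrE ?invr_gt0//.
by rewrite (le_trans _ mx)// le_max lexx orbT.
Qed.

(** Euler's integral truncated to the segment [a, b]. *)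
Definition tGamma (R : realType) (s a b : R) : \bar R :=
  (\int[lebesgue_measure]_(t in `[a, b]) (t `^ (s - 1) * expR (- t))%:E)%E.

Lemma cvg_integral_Gamma (R : realType) (s : R) :
  (fun n : nat => tGamma s n.+2%:R^-1 n.+2%:R) @ \oo --> eGamma s.
Proof.
rewrite /tGamma /eGamma -bigcup_itv_invn_n.
apply: ge0_nondecreasing_set_cvg_integral => //.
- apply/nondecreasing_seqP => n; rewrite subsetEset.
  apply: subset_itv; rewrite bnd_simp ?ler_nat//.
  by rewrite lef_pV2 ?posrE// ler_nat.
- by move=> n; exact: measurable_Gamma_integrand.
- by move=> n x _; rewrite lee_fin mulr_ge0 ?powR_ge0 ?expR_ge0.
Qed.

(** The functional equation, as the limit of integrations by parts over
    [1/n, n]; the boundary terms vanish at both ends. *)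
Lemma eGamma_succ (R : realType) (s : R) : 0 < s ->
  eGamma (s + 1) = (s%:E * eGamma s)%E.
Proof.
move=> s0.
pose I z (n : nat) : \bar R := tGamma z n.+2%:R^-1 n.+2%:R.
pose c n : R := n.+2%:R^-1 `^ s * expR (- n.+2%:R^-1) - n.+2%:R `^ s * expR (- n.+2%:R).
have c0 : c @ \oo --> (0 : R).
  rewrite -[X in _ --> X](subr0 0); apply: cvgB; last first.
    by have := @cvg_powRM_expRN R s; rewrite -(cvg_shiftn 2); under eq_fun do rewrite addn2.
  have h : (fun n => n.+2%:R^-1 `^ s : R) @ \oo --> (0 : R).
    move: (powR_cvg0 s0) => /cvg_at_rightP; apply; split.
      by move=> n; rewrite invr_gt0.
    exact: cvg_invn2.
  apply: (squeeze_cvgr _ (cvg_cst 0) h).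
  apply: nearW => n /=; rewrite mulr_ge0 ?powR_ge0 ?expR_ge0//=.
  by rewrite ler_piMr ?powR_ge0// expR_le1 oppr_le0.
have e n : I (s + 1) n = ((c n)%:E + s%:E * I s n)%E.
  rewrite /I /tGamma addrK integral_Gamma_by_parts// ?invr_gt0//.
  by rewrite (@lt_trans _ _ 1)// ?invf_lt1// ?ltr1n.
have h1 := @cvg_integral_Gamma R (s + 1).
rewrite -[RHS]add0e.
apply: (cvg_unique _ h1) => //.
rewrite -/(I (s + 1)) (_ : I (s + 1) = fun n => ((c n)%:E + s%:E * I s n)%E); last exact/funext.
apply: cvgeD => //.
- by apply: cvg_EFin; [exact: nearW|exact: c0].
- by apply: cvgeZl => //; exact: cvg_integral_Gamma.
Qed.

Lemma eGamma1 (R : realType) : eGamma (1 : R) = 1%E.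
Proof.
pose I (n : nat) : \bar R := tGamma 1 n.+2%:R^-1 n.+2%:R.
have c0 : (fun n => expR (- n.+2%:R^-1) - expR (- n.+2%:R) : R) @ \oo --> (1 : R).
  rewrite -[X in _ --> X](subr0 1); apply: cvgB; last first.
    by have := @cvgn_expR R; rewrite -(cvg_shiftn 2); under eq_fun do rewrite addn2.
  rewrite -[X in _ --> X]expR0 -[X in _ --> expR X]oppr0.
  apply: (cvg_comp _ expR (cvgN (@cvg_invn2 R))); exact: continuous_expR.
have h := @cvg_integral_Gamma R 1.
apply: (cvg_unique _ h) => //.
rewrite -/I (_ : I = fun n => (expR (- n.+2%:R^-1) - expR (- n.+2%:R))%:E).
  by apply: cvg_EFin; [exact: nearW|exact: c0].
apply/funext => n.
rewrite /I /tGamma subrr integral_Gamma_by_parts// ?invr_gt0//.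
  by rewrite !powRr0 !mul1r mul0e adde0.
by rewrite (@lt_trans _ _ 1)// ?invf_lt1// ?ltr1n.
Qed.

(** Wendel's inequality.  It follows from the bound of t^x by its tangent at
    t = s; the integral of the tangent is computed by the functional equation. *)
Lemma eGamma_addr_le (R : realType) (s x : R) :
  0 < s -> 0 <= x <= 1 ->
  (eGamma (s + x) <= (s `^ x)%:E * eGamma s)%E.
Proof.
move=> s0 /andP[x0 x1]; have es := eGamma_succ s0.
have sx0 : 0 <= s `^ x by exact: powR_ge0.
have nn z (t : R) : (0 <= (t `^ z * expR (- t))%:E)%E.
  by rewrite lee_fin mulr_ge0 ?powR_ge0 ?expR_ge0.
(* The right-hand side is the integral of s^x (1 - x + x t/s) t^(s-1) e^-t. *)
have -> : ((s `^ x)%:E * eGamma s =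
    \int[lebesgue_measure]_(t in `]0%R, +oo[)
      ((s `^ x * (1 - x))%:E * (t `^ (s - 1) * expR (- t))%:E +
       (s `^ x * x / s)%:E * (t `^ (s + 1 - 1) * expR (- t))%:E))%E.
  rewrite ge0_integralD//=; last 4 first.
  - by move=> t _; rewrite mule_ge0// lee_fin; nra.
  - by apply: measurable_funeM; exact: measurable_Gamma_integrand.
  - by move=> t _; rewrite mule_ge0// lee_fin divr_ge0 ?mulr_ge0// ltW.
  - by apply: measurable_funeM; exact: measurable_Gamma_integrand.
  rewrite !ge0_integralZl_EFin//; last 4 first.
  - exact: measurable_Gamma_integrand.
  - by rewrite divr_ge0 ?mulr_ge0// ltW.
  - exact: measurable_Gamma_integrand.
  - nra.
  rewrite -/(eGamma s) -/(eGamma (s + 1)) es muleA -EFinM divfK ?gt_eqF//.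
  rewrite -ge0_muleDl ?lee_fin ?mulr_ge0//; last nra.
  by rewrite -EFinD -mulrDr subrK mulr1.
apply: ge0_le_integral => //=.
- exact: measurable_Gamma_integrand.
- apply: emeasurable_funD; apply: measurable_funeM; exact: measurable_Gamma_integrand.
move=> t; rewrite in_itv/= andbT => t0.
rewrite -!EFinM -EFinD lee_fin.
have -> : s + x - 1 = s - 1 + x by lra.
have tn : t != 0 by rewrite gt_eqF.
have -> : s + 1 - 1 = s - 1 + 1 by lra.
rewrite (powRD (r := s - 1) (s := x)) ?tn ?implybT//.
rewrite (powRD (r := s - 1) (s := 1)) ?tn ?implybT// powRr1 ?(ltW t0)//.
have -> : t `^ x = s `^ x * (t / s) `^ x.
  by rewrite -powRM ?divr_ge0 ?(ltW s0) ?(ltW t0)// mulrC divfK ?gt_eqF.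
have h : (t / s) `^ x <= 1 - x + x * (t / s).
  by apply: powR_le_tangent1; rewrite ?x0 ?divr_gt0.
have e : s `^ x * (1 - x) * (t `^ (s - 1) * expR (- t)) +
  s `^ x * x / s * (t `^ (s - 1) * t * expR (- t)) =
  (t `^ (s - 1) * expR (- t) * s `^ x) * (1 - x + x * (t / s)) by field; rewrite gt_eqF.
rewrite e.
have -> : t `^ (s - 1) * (s `^ x * (t / s) `^ x) * expR (- t) =
  (t `^ (s - 1) * expR (- t) * s `^ x) * (t / s) `^ x by ring.
by apply: ler_wpM2l => //; rewrite !mulr_ge0 ?powR_ge0 ?expR_ge0.
Qed.

(** For s <= 1, finiteness comes from Gamma(1 + s) <= Gamma(1) and positivity
    from 1 = Gamma(s + (1 - s)) <= s^(1 - s) Gamma(s); the functional equation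
    carries both to larger s. *)
Lemma eGamma_fin_gt0 (R : realType) (s : R) :
  0 < s -> eGamma s \is a fin_num /\ (0 < eGamma s)%E.
Proof.
have base (t : R) : 0 < t -> t <= 1 -> eGamma t \is a fin_num /\ (0 < eGamma t)%E.
  move=> t0 t1.
  have fin : eGamma t \is a fin_num.
    have h : (eGamma (t + 1) <= 1)%E.
      rewrite addrC (le_trans (eGamma_addr_le _ _)) ?ltr01 ?(ltW t0)//.
      by rewrite powR1 eGamma1 mule1.
    rewrite ge0_fin_numE ?eGamma_ge0//; rewrite eGamma_succ// in h.
    case: (eGamma t) h (eGamma_ge0 t) => [r|/=|//] h _; first by rewrite ltry.
    by move: h; rewrite gt0_muley.
  split=> //; rewrite lt_neqAle eGamma_ge0 andbT eq_sym; apply/negP => /eqP e0.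
  have := eGamma_addr_le t0 (x := 1 - t); rewrite e0 (addrC t (1 - t)) subrK eGamma1 mule0.
  have t1' : 0 <= 1 - t <= 1 by rewrite subr_ge0 t1/= gerBl ltW.
  by move=> /(_ t1'); rewrite lee_fin ler10.
move=> s0; have [n] : exists n : nat, s <= n.+1%:R.
  by exists (Num.truncn s); apply: ltW; exact: truncnS_gt.
elim: n s s0 => [|n IH] s s0 sn; first by apply: base.
have [s1|s1] := leP s 1; first exact: base.
have s10 : 0 < s - 1 by rewrite subr_gt0.
have [|f p] := IH (s - 1) s10; first by rewrite lerBlDr natr1.
rewrite -(subrK 1 s) eGamma_succ//; split; first by rewrite fin_numM.
by rewrite mule_gt0.
Qed.

Section RealGamma.
Variable R : realType.
Implicit Types (s x : R) (n : nat).

Lemma Gamma_gt0 s : 0 < s -> 0 < Gamma s.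
Proof.
move=> s0; have [f p] := eGamma_fin_gt0 s0.
by rewrite Gamma_fine fine_gt0// p ltey_eq f.
Qed.

Lemma Gamma_succ s : 0 < s -> Gamma (s + 1) = s * Gamma s.
Proof.
move=> s0; have [f p] := eGamma_fin_gt0 s0.
by rewrite !Gamma_fine eGamma_succ// fineM.
Qed.

Lemma Gamma1 : Gamma (1 : R) = 1.
Proof. by rewrite Gamma_fine eGamma1. Qed.

Lemma Gamma_addr_le s x : 0 < s -> 0 <= x <= 1 -> Gamma (s + x) <= s `^ x * Gamma s.
Proof.
move=> s0 x01; have [f p] := eGamma_fin_gt0 s0.
have sx : 0 < s + x by case/andP: x01 => ? _; rewrite ltr_wpDr.
have [f' _] := eGamma_fin_gt0 sx.
rewrite -lee_fin EFinM (Gamma_fine (s + x)) (Gamma_fine s) !fineK//.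
exact: eGamma_addr_le.
Qed.

Lemma Gamma_prod x n : -1 < x ->
  Gamma (n.+1%:R + x) = Gamma (1 + x) * \prod_(k < n) (k.+1%:R + x).
Proof.
move=> x1; elim: n => [|n IH]; first by rewrite big_ord0 mulr1.
rewrite big_ord_recr/= mulrA -IH mulrC -Gamma_succ; last by have := ler0n R n; lra.
by congr (Gamma _); rewrite -[in LHS]natr1; lra.
Qed.

Lemma Gamma_nat n : Gamma (n.+1%:R : R) = n`!%:R.
Proof.
rewrite -[n.+1%:R]addr0 Gamma_prod ?ltrN10// addr0 Gamma1 mul1r.
elim: n => [|n IH]; first by rewrite big_ord0 fact0.
by rewrite big_ord_recr/= IH factS natrM mulrC addr0.
Qed.

(** The quotient Gamma(m + x)/Gamma(m), with m = n + 2, lies between (m - 1)^x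
    and m^x for x in [0, 1]: the upper bound is Wendel's inequality at m, the
    lower one is the same inequality at m - 1 + x with exponent 1 - x. *)
Lemma ln_Gamma_ge0_bounds x n : 0 <= x <= 1 ->
  x * ln n.+1%:R <= ln (Gamma (n.+2%:R + x)) - ln n.+1`!%:R <= x * ln n.+2%:R.
Proof.
move=> /andP[x0 x1].
have f0 : (0 : R) < n.+1`!%:R by rewrite ltr0n fact_gt0.
have g0 : 0 < Gamma (n.+2%:R + x) by apply: Gamma_gt0; rewrite ltr_wpDr.
have np0 m : (0 : R) < m.+1%:R by rewrite ltr0n.
rewrite lerBrDr lerBlDr -!ln_powR -!lnM ?posrE ?powR_gt0//.
rewrite !ler_ln ?posrE ?mulr_gt0 ?powR_gt0// -Gamma_nat; apply/andP; split; last first.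
  by apply: Gamma_addr_le; rewrite ?x0.
have n1x0 : 0 < n.+1%:R + x by rewrite ltr_wpDr.
have -> : Gamma (n.+2%:R + x) = (n.+1%:R + x) * Gamma (n.+1%:R + x).
  by rewrite -Gamma_succ//; congr (Gamma _); rewrite -[in LHS]natr1; lra.
have h := @Gamma_addr_le (n.+1%:R + x) (1 - x) n1x0.
have -> : Gamma n.+2%:R = Gamma (n.+1%:R + x + (1 - x)).
  by congr (Gamma _); rewrite -natr1; lra.
apply: (@le_trans _ _ (n.+1%:R `^ x * ((n.+1%:R + x) `^ (1 - x) * Gamma (n.+1%:R + x)))).
  by rewrite ler_wpM2l ?powR_ge0// h// subr_ge0 x1 gerBl.
rewrite mulrA ler_wpM2r ?(ltW (Gamma_gt0 _))//.
have e : (n.+1%:R + x) `^ x * (n.+1%:R + x) `^ (1 - x) = n.+1%:R + x.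
  by rewrite -powRD ?(gt_eqF n1x0) ?implybT// (addrC x (1 - x)) subrK powRr1// ltW.
rewrite -[leRHS]e ler_wpM2r ?powR_ge0//.
by apply: ge0_ler_powR => //; rewrite ?nnegrE ?lerDl// ltW.
Qed.

(** The analogue for negative x, with the two bounds exchanged. *)
Lemma ln_Gamma_le0_bounds x n : -1 < x <= 0 ->
  x * ln n.+2%:R <= ln (Gamma (n.+2%:R + x)) - ln n.+1`!%:R <= x * ln n.+1%:R.
Proof.
move=> /andP[x1 x0].
have f0 : (0 : R) < n.+1`!%:R by rewrite ltr0n fact_gt0.
have np0 m : (0 : R) < m.+1%:R by rewrite ltr0n.
have a0 : 0 < n.+2%:R + x by have := ler0n R n.+1; rewrite -[n.+2%:R]natr1; lra.
have g0 : 0 < Gamma (n.+2%:R + x) by apply: Gamma_gt0.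
rewrite lerBrDr lerBlDr -!ln_powR -!lnM ?posrE ?powR_gt0//.
rewrite !ler_ln ?posrE ?mulr_gt0 ?powR_gt0//; apply/andP; split.
  have h : Gamma n.+2%:R <= (n.+2%:R + x) `^ (- x) * Gamma (n.+2%:R + x).
    by rewrite -{1}(addrK x n.+2%:R) Gamma_addr_le//; lra.
  have e : n.+2%:R `^ x * n.+2%:R `^ (- x) = 1 :> R.
    by rewrite powRN divff// gt_eqF ?powR_gt0.
  rewrite -[leRHS]mul1r -[X in _ <= X * _]e -mulrA ler_wpM2l ?powR_ge0// -Gamma_nat (le_trans h)//.
  rewrite ler_wpM2r ?(ltW g0)//.
  by apply: ge0_ler_powR; rewrite ?nnegrE ?oppr_ge0 ?ler0n ?(ltW a0)//; lra.
have -> : n.+2%:R + x = n.+1%:R + (1 + x) by rewrite -natr1; lra.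
rewrite (le_trans (Gamma_addr_le _ _))//; first by lra.
rewrite powRD ?(gt_eqF (np0 _)) ?implybT// powRr1 ?(ltW (np0 _))//.
by rewrite Gamma_nat factS natrM mulrCA mulrA lexx.
Qed.

End RealGamma.

(** * The logarithm of Gamma near 1 *)

Section LogGamma.
Variable R : realType.
Implicit Types (x : R) (n K : nat).

Lemma sum_ln1p_taylor x n K : `|x| <= 2^-1 ->
  `|\sum_(k < n) (x / k.+1%:R - ln (1 + x / k.+1%:R))
    - \sum_(j < K) (-1) ^+ j * x ^+ j.+2 / j.+2%:R * zetap R n j.+2|
  <= 4 * `|x| ^+ K.+2.
Proof.
move=> x2.
have -> : \sum_(j < K) (-1) ^+ j * x ^+ j.+2 / j.+2%:R * zetap R n j.+2 =
  \sum_(k < n) \sum_(j < K) (-1) ^+ j * (x / k.+1%:R) ^+ j.+2 / j.+2%:R.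
  rewrite exchange_big; apply: eq_bigr => j _.
  rewrite /zetap mulr_sumr; apply: eq_bigr => k _.
  by rewrite expr_div_n; ring.
rewrite -sumrB (le_trans (ler_norm_sum _ _ _))//.
have e : \sum_(k < n) 2 * (`|x| ^+ K.+2 * (k.+1%:R : R) ^- K.+2) = 2 * `|x| ^+ K.+2 * zetap R n K.+2.
  by rewrite /zetap mulr_sumr; apply: eq_bigr => k _; rewrite mulrA.
apply: (@le_trans _ _ (2 * `|x| ^+ K.+2 * zetap R n K.+2)).
  rewrite -e; apply: ler_sum => k _.
  have xk : `|x / k.+1%:R| = `|x| / k.+1%:R.
    by rewrite normrM normfV (ger0_norm (ler0n _ _)).
  rewrite -exprVn -exprMn -xk ln1p_taylor// xk.
  by apply: le_trans x2; rewrite ler_piMr// invf_le1 ?ltr0n// ler1n.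
have -> : 4 * `|x| ^+ K.+2 = 2 * `|x| ^+ K.+2 * 2 by ring.
by apply: ler_wpM2l; [rewrite mulr_ge0 ?exprn_ge0|exact: zetap_le2].
Qed.

(** Euler's product for Gamma(1 + x) with an error term. *)
Lemma ln_Gamma1D_approx x n : `|x| <= 2^-1 ->
  `|ln (Gamma (1 + x)) - (x * ln n.+2%:R - \sum_(k < n.+1) ln (1 + x / k.+1%:R))|
  <= n.+1%:R^-1.
Proof.
rewrite ler_norml => /andP[xl xu].
have x1 : -1 < x by lra.
have p1x : 0 < 1 + x by lra.
have kx0 (k : nat) : 0 < k.+1%:R + x.
  by rewrite -natr1; have := ler0n R k; lra.
have np0 m : (0 : R) < m.+1%:R by rewrite ltr0n.
have e1 : ln (Gamma (n.+2%:R + x)) = ln (Gamma (1 + x)) + \sum_(k < n.+1) ln (k.+1%:R + x).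
  rewrite Gamma_prod// lnM ?posrE ?Gamma_gt0//; last by apply: prodr_gt0.
  congr (_ + _); elim: n.+1 => [|m IH]; first by rewrite !big_ord0 ln1.
  by rewrite !big_ord_recr/= lnM ?posrE ?prodr_gt0// IH.
have e2 : ln n.+1`!%:R = \sum_(k < n.+1) ln k.+1%:R :> R.
  elim: n.+1 => [|m IH]; first by rewrite big_ord0 fact0 ln1.
  by rewrite big_ord_recr/= factS natrM lnM ?posrE ?ltr0n ?fact_gt0// IH addrC.
have e3 : \sum_(k < n.+1) ln (1 + x / k.+1%:R) =
    \sum_(k < n.+1) ln (k.+1%:R + x) - \sum_(k < n.+1) ln k.+1%:R.
  rewrite -sumrB; apply: eq_bigr => k _; rewrite -ln_div ?posrE//.
  by rewrite mulrDl divff// pnatr_eq0.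
have -> : ln (Gamma (1 + x)) - (x * ln n.+2%:R - \sum_(k < n.+1) ln (1 + x / k.+1%:R)) =
   ln (Gamma (n.+2%:R + x)) - ln n.+1`!%:R - x * ln n.+2%:R.
  by rewrite e1 e2 e3; ring.
have d0 : ln n.+2%:R - ln n.+1%:R <= n.+1%:R^-1 :> R.
  rewrite -ln_div ?posrE// -[n.+2%:R]natr1 mulrDl divff ?pnatr_eq0// mul1r le_ln1Dx//.
  by rewrite (lt_le_trans (ltrN10 _)).
have d1 : 0 <= ln n.+2%:R - ln n.+1%:R :> R.
  by rewrite subr_ge0 ler_ln ?posrE// ler_nat.
set L := ln (Gamma _) - _; rewrite ler_norml.
set d := n.+1%:R^-1 in d0 *; set a := ln n.+2%:R in d0 d1 *; set b := ln n.+1%:R in d0 d1.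
have [x0|x0] := leP 0 x.
  have x01 : 0 <= x <= 1 by clear -xu x0; lra.
  have /andP[] := ln_Gamma_ge0_bounds n x01.
  by rewrite -/L -/a -/b; clearbody L a b d; clear -d0 d1 x0 xl xu => h1 h2; apply/andP; split; nra.
have x01 : -1 < x <= 0 by clear -x1 x0; lra.
have /andP[] := ln_Gamma_le0_bounds n x01.
by rewrite -/L -/a -/b; clearbody L a b d; clear -d0 d1 x0 xl xu => h1 h2; apply/andP; split; nra.
Qed.

Lemma ln_Gamma1D_taylor x K : `|x| <= 2^-1 ->
  `|ln (Gamma (1 + x)) + euler_gamma R * x
    - \sum_(j < K) (-1) ^+ j * x ^+ j.+2 / j.+2%:R * zeta j.+2%:R|
  <= 4 * `|x| ^+ K.+2.
Proof.
move=> x2.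
pose u n := ln (Gamma (1 + x)) + euler_seq R n.+1 * x
    - \sum_(j < K) (-1) ^+ j * x ^+ j.+2 / j.+2%:R * zetap R n.+1 j.+2.
apply: (@cvg_norm_le _ u (fun n => n.+1%:R^-1 + 4 * `|x| ^+ K.+2)).
- apply: cvgB.
    apply: cvgD; first exact: cvg_cst.
    by apply: cvgM; [rewrite cvg_shiftS; exact: cvg_euler_seq|exact: cvg_cst].
  apply: (@cvg_sumr _ _ _ (fun (j : 'I_K) n => _ * zetap R n.+1 j.+2)) => j.
  apply: cvgM; first exact: cvg_cst.
  by rewrite (cvg_shiftS (zetap R ^~ j.+2)); exact: cvg_zetap.
- rewrite -[X in _ --> X]add0r; apply: cvgD; first exact: cvg_harmonic.
  exact: cvg_cst.
move=> n.
have h1 := ln_Gamma1D_approx n x2.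
have h2 := sum_ln1p_taylor n.+1 K x2.
apply: le_trans (lerD h1 h2); apply: le_trans (ler_normD _ _).
(* x ln (n + 2) and the linear terms x/k combine into the Euler sequence. *)
suff -> : u n = ln (Gamma (1 + x)) -
     (x * ln n.+2%:R - \sum_(k < n.+1) ln (1 + x / k.+1%:R)) +
     (\sum_(k < n.+1) (x / k.+1%:R - ln (1 + x / k.+1%:R)) -
      \sum_(j < K) (-1) ^+ j * x ^+ j.+2 / j.+2%:R * zetap R n.+1 j.+2) by [].
rewrite /u euler_seqE sumrB -mulr_sumr; ring.
Qed.

(** The Taylor estimate with no term beyond the linear one already contains
    the differentiability of ln Gamma at 1. *)
Lemma digamma1 : digamma (1 : R) = - euler_gamma R.
Proof.
rewrite /digamma Gamma1 divr1 derive1E.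
pose G (x : R) := ln (Gamma x).
have dG : is_derive (1 : R) 1 G (- euler_gamma R).
  have h : (fun h : R => h^-1 *: ((G \o shift (1 : R)) (h *: (1 : R)) - G 1)) @ 0^' --> (- euler_gamma R : R).
    apply/cvgrPdist_le => /= e e0; near=> h.
    have hn0 : h != 0 by near: h; exact: nbhs_dnbhs_neq.
    have h2 : `|h| <= 2^-1.
      near: h; apply: dnbhs0_le; by rewrite invr_gt0.
    have he : `|h| <= e / 4.
      near: h; apply: dnbhs0_le; by rewrite divr_gt0.
    have := ln_Gamma1D_taylor 0 h2; rewrite big_ord0 subr0.
    rewrite /G Gamma1 ln1 subr0 /= /GRing.scale/= mulr1 (addrC h 1).
    set L := ln _ => hL.
    have -> : - euler_gamma R - h^-1 * L = - (h^-1 * (L + euler_gamma R * h)).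
      by field.
    rewrite normrN normrM normfV mulrC ler_pdivrMr ?normr_gt0//.
    apply: le_trans hL _; rewrite expr2 mulrA ler_wpM2r//.
    by move: he; rewrite ler_pdivlMr// mulrC.
  apply: DeriveDef; first by apply: cvgP h.
  exact: cvg_lim h.
have dE : is_derive (1 : R) 1 (expR \o G) (- euler_gamma R).
  have := is_derive1_comp (is_derive_expR (G 1)) dG.
  by rewrite /G Gamma1 ln1 expR0 mul1r.
rewrite (@near_eq_derive _ _ _ _ (expR \o G))//.
  exact: derive_val.
near=> z; rewrite /= /G lnK// posrE Gamma_gt0//.
near: z; exact: lt_nbhsr.
Unshelve. all: by end_near.
Qed.

End LogGamma.

(** * The functional on zero-free digit strings *)

Section Transfer.
Variables (R : realType) (b : nat).
Hypothesis b2 : (2 <= b)%N.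
Implicit Types (f g : R -> R) (x y : R).

(** The transfer operator of the maps x |-> (d + x)/b for the nonzero digits d. *)
Definition transfer f x : R := b%:R^-1 * \sum_(1 <= d < b) f ((d%:R + x) / b%:R).

(** The measure mu restricted to strings of fewer than L nonzero digits: the
    sum of b^-l f(X/b^l) over the strings X of length l < L. *)
Definition kmass L f : R := \sum_(l < L) iter l transfer f 0.

(** The factor by which the mass changes when strings get one digit longer:
    there are b - 1 nonzero digits, each of weight 1/b. *)
Definition ratio : R := (b.-1)%:R / b%:R.

Let b0 : (0 : R) < b%:R. Proof. by rewrite ltr0n ltnW. Qed.
Let bn0 : b%:R != 0 :> R. Proof. by rewrite gt_eqF. Qed.

Lemma ratio_ge0 : 0 <= ratio. Proof. by rewrite divr_ge0. Qed.

Lemma ratioE : ratio = 1 - b%:R^-1.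
Proof.
by rewrite /ratio -subn1 natrB ?(ltnW b2)// mulrBl divff// mul1r.
Qed.

Lemma ratio_lt1 : ratio < 1.
Proof. by rewrite ratioE gtrBl invr_gt0. Qed.

Lemma transfer_sum (I : Type) (r : seq I) (c : I -> R) (f : I -> R -> R) :
  transfer (fun x => \sum_(i <- r) c i * f i x) = fun x => \sum_(i <- r) c i * transfer (f i) x.
Proof.
apply/funext => x; rewrite /transfer exchange_big mulr_sumr; apply: eq_bigr => i _.
by rewrite -mulr_sumr mulrCA.
Qed.

Lemma iter_transfer_sum (I : Type) (r : seq I) (c : I -> R) (f : I -> R -> R) l :
  iter l transfer (fun x => \sum_(i <- r) c i * f i x) =
  fun x => \sum_(i <- r) c i * iter l transfer (f i) x.
Proof. by elim: l => //= l ->; exact: transfer_sum. Qed.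

Lemma kmass_sum (I : Type) (r : seq I) (c : I -> R) (f : I -> R -> R) L :
  kmass L (fun x => \sum_(i <- r) c i * f i x) = \sum_(i <- r) c i * kmass L (f i).
Proof.
rewrite /kmass; under eq_bigr do rewrite iter_transfer_sum.
by rewrite exchange_big; apply: eq_bigr => i _; rewrite mulr_sumr.
Qed.

Lemma kmassZ c f L : kmass L (fun x => c * f x) = c * kmass L f.
Proof.
have := @kmass_sum unit [:: tt] (fun=> c) (fun=> f) L.
by under eq_fun do rewrite big_seq1; rewrite big_seq1.
Qed.

Lemma kmassB f g L : kmass L (fun x => f x - g x) = kmass L f - kmass L g.
Proof.
have := @kmass_sum bool [:: true; false] (fun i => if i then 1 else -1)
  (fun i => if i then f else g) L.
rewrite big_cons big_seq1 mul1r mulN1r => <-.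
by congr kmass; apply/funext => x; rewrite big_cons big_seq1 mul1r mulN1r.
Qed.

Lemma kmassD f g L : kmass L (fun x => f x + g x) = kmass L f + kmass L g.
Proof.
have := @kmass_sum bool [:: true; false] (fun=> 1) (fun i => if i then f else g) L.
rewrite big_cons big_seq1 !mul1r => <-.
by congr kmass; apply/funext => x; rewrite big_cons big_seq1 !mul1r.
Qed.

Lemma child_itv x d : 0 <= x <= 1 -> (d < b)%N -> 0 <= (d%:R + x) / b%:R <= 1.
Proof.
move=> /andP[x0 x1] db; rewrite divr_ge0 ?addr_ge0//= ler_pdivrMr// mul1r.
by apply: (@le_trans _ _ (d.+1%:R)); rewrite ?ler_nat// -natr1 lerD2l.
Qed.

(** All the points (d + x)/b stay in [0, 1], so only values there matter. *)
Lemma iter_transfer_le f g l : (forall x, 0 <= x <= 1 -> f x <= g x) ->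
  forall x, 0 <= x <= 1 -> iter l transfer f x <= iter l transfer g x.
Proof.
move=> fg; elim: l => //= l IH x x01; rewrite /transfer ler_wpM2l ?invr_ge0//.
by apply: ler_sum_nat => d /andP[_ db]; apply: IH; exact: child_itv.
Qed.

Lemma kmass_le f g L : (forall x, 0 <= x <= 1 -> f x <= g x) -> kmass L f <= kmass L g.
Proof.
by move=> fg; apply: ler_sum => l _; apply: iter_transfer_le => //; rewrite lexx ler01.
Qed.

Lemma kmass_eq f g L : (forall x, 0 <= x <= 1 -> f x = g x) -> kmass L f = kmass L g.
Proof.
by move=> fg; apply/eqP; rewrite eq_le !kmass_le// => x /fg ->.
Qed.

Lemma iter_transfer_cst c l : iter l transfer (fun=> c) = fun=> c * ratio ^+ l.
Proof.
elim: l => [|l /= ->]; first by apply/funext => x; rewrite expr0 mulr1.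
apply/funext => x; rewrite /transfer sumr_const_nat subn1 exprS -[_ *+ b.-1]mulr_natr.
by set p := ratio ^+ l; rewrite /ratio; ring.
Qed.

Lemma kmass1 L : kmass L (fun=> 1) = b%:R * (1 - ratio ^+ L).
Proof.
rewrite /kmass; under eq_bigr do rewrite iter_transfer_cst mul1r.
have e : 1 - ratio = b%:R^-1 by rewrite ratioE opprB addrCA subrr addr0.
have -> : 1 - ratio ^+ L = b%:R^-1 * \sum_(l < L) ratio ^+ l.
  by rewrite -e -opprB subrX1 -mulNr opprB.
by rewrite mulrA divff// mul1r.
Qed.

Lemma cvg_kmass1 : (fun L => kmass L (fun=> 1)) @ \oo --> (b%:R : R).
Proof.
under eq_fun do rewrite kmass1.
have h : (fun L => b%:R * (1 - ratio ^+ L)) @ \oo --> (b%:R * (1 - 0) : R).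
  apply: cvgM; first exact: cvg_cst.
  apply: cvgB; first exact: cvg_cst.
  by apply: cvg_expr; rewrite ger0_norm ?ratio_lt1// ratio_ge0.
by rewrite subr0 mulr1 in h.
Qed.

Lemma kmass1_le L : kmass L (fun=> 1) <= b%:R.
Proof. by rewrite kmass1 ler_piMr ?ler0n// gerBl exprn_ge0// ratio_ge0. Qed.

(** The functional equation mu(f) = f(0) + mu(Tf): nonempty strings are sorted
    by their first digit. *)
Lemma kmassS L f : kmass L.+1 f = f 0 + kmass L (transfer f).
Proof.
by rewrite /kmass big_ord_recl; congr (_ + _); apply: eq_bigr => l _; rewrite -iterSr.
Qed.

Lemma kmassSr L f : kmass L.+1 f = kmass L f + iter L transfer f 0.
Proof. by rewrite /kmass big_ord_recr. Qed.

Lemma iter_transfer_cvg0 f c : (forall x, 0 <= x <= 1 -> `|f x| <= c) ->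
  (fun L => iter L transfer f 0) @ \oo --> (0 : R).
Proof.
move=> fc.
have h : (fun L => c * ratio ^+ L) @ \oo --> (0 : R).
  rewrite -[X in _ --> X](mulr0 c); apply: cvgM; first exact: cvg_cst.
  by apply: cvg_expr; rewrite ger0_norm ?ratio_lt1// ratio_ge0.
have z01 : 0 <= (0 : R) <= 1 by rewrite lexx ler01.
apply: (@squeeze_cvgr _ _ _ _ (fun L => - (c * ratio ^+ L)) (fun L => c * ratio ^+ L)) => //.
  apply: nearW => L; have := iter_transfer_cst c L; have := iter_transfer_cst (- c) L.
  move=> /(congr1 (@^~ 0)) e1 /(congr1 (@^~ 0)) e2.
  rewrite -mulNr -e1 -e2 !iter_transfer_le// => x /fc; rewrite ler_norml => /andP[]//.
by rewrite -oppr0; exact: cvgN.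
Qed.

Lemma kmass_norm_le f g L : (forall x, 0 <= x <= 1 -> `|f x| <= g x) ->
  `|kmass L f| <= kmass L g.
Proof.
move=> fg; rewrite ler_norml; apply/andP; split; last first.
  by apply: kmass_le => x /fg; rewrite ler_norml => /andP[].
rewrite -mulN1r -kmassZ.
by apply: kmass_le => x /fg; rewrite ler_norml mulN1r => /andP[].
Qed.

(** The k-th moment mu(x^k) of the full measure. *)
Definition kmom k : R := lim ((fun L => kmass L (fun x => x ^+ k)) @ \oo).

Lemma cvg_kmom k : (fun L => kmass L (fun x => x ^+ k)) @ \oo --> kmom k.
Proof.
apply: nondecreasing_is_cvgn.
  apply/nondecreasing_seqP => L; rewrite kmassSr lerDl.
  have h0 : iter L transfer (fun=> 0) 0 = 0 by rewrite iter_transfer_cst mul0r.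
  rewrite -[leLHS]h0.
  apply: iter_transfer_le; last by rewrite lexx ler01.
  by move=> x /andP[x0 _]; rewrite exprn_ge0.
exists b%:R => _ [L _ <-]; apply: le_trans (kmass1_le L).
by apply: kmass_le => x /andP[x0 x1]; rewrite exprn_ile1.
Qed.

Lemma kmom0 : kmom 0 = b%:R.
Proof. by apply/cvg_lim => //; exact: cvg_kmass1. Qed.

Definition power_sum p : R := \sum_(1 <= d < b) d%:R ^+ p.

Lemma transfer_exp k x : transfer (fun x => x ^+ k) x =
  \sum_(j < k.+1) (b%:R ^- k.+1 * ('C(k, j)%:R * power_sum (k - j))) * x ^+ j.
Proof.
rewrite /transfer.
under eq_bigr do rewrite expr_div_n exprDn mulr_suml.
rewrite exchange_big mulr_sumr; apply: eq_bigr => j _.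
rewrite /power_sum !mulr_sumr mulr_suml; apply: eq_bigr => d _.
by rewrite -[_ *+ 'C(_, _)]mulr_natl exprS invfM; ring.
Qed.

(** The recurrence obtained from the functional equation and the binomial
    theorem; the sum on the right contains the moment on the left. *)
Lemma kmom_rec k : kmom k.+1 =
  \sum_(j < k.+2) (b%:R ^- k.+2 * ('C(k.+1, j)%:R * power_sum (k.+1 - j))) * kmom j.
Proof.
have h : (fun L => kmass L.+1 (fun x => x ^+ k.+1)) @ \oo --> kmom k.+1.
  by rewrite (cvg_shiftS (fun L => kmass L (fun x => x ^+ k.+1))); exact: cvg_kmom.
apply: (cvg_unique _ h) => //.
have -> : (fun L => kmass L.+1 (fun x => x ^+ k.+1)) = fun L => \sum_(j < k.+2)
    (b%:R ^- k.+2 * ('C(k.+1, j)%:R * power_sum (k.+1 - j))) * kmass L (fun x => x ^+ j).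
  apply/funext => L; rewrite kmassS expr0n add0r -kmass_sum.
  by apply: kmass_eq => x _; exact: transfer_exp.
apply: (@cvg_sumr _ _ _ (fun (j : 'I_k.+2) L => _ * kmass L (fun x => x ^+ j))) => j.
by apply: cvgM; [exact: cvg_cst|exact: cvg_kmom].
Qed.

End Transfer.

(** * The digamma series and the multiplication formula *)

(** Euclidean division of the summation index by b. *)
Lemma big_nat_mul_block (R : realType) (b p r : nat) (F : nat -> R) : (p <= r)%N ->
  \sum_(b * p <= m < b * r) F m = \sum_(p <= q < r) \sum_(0 <= d < b) F (b * q + d)%N.
Proof.
move=> /subnK <-; elim: (r - p)%N => [|k IH]; first by rewrite !add0n !big_geq.
rewrite addSn big_nat_recr ?leq_addl//= -IH.
rewrite (@big_cat_nat _ _ _ (b * (k + p))%N) ?leq_mul2l ?leq_addl ?leqnSn ?orbT//=.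
congr (_ + _); rewrite mulnSr -{1}[(b * (k + p))%N]add0n big_addn addKn.
by apply: eq_bigr => d _; rewrite addnC.
Qed.

Section Harmonic.
Variable R : realType.
Implicit Types (x y : R) (n N : nat).

(** Partial sums of h(y) = sum_(n >= 1) (1/n - 1/(n + y)). *)
Definition harm_seq y n : R := \sum_(k < n) (k.+1%:R^-1 - (k.+1%:R + y)^-1).

(** The series h(y) = psi(1 + y) - psi(1), for y >= 0. *)
Definition harm y : R := lim (harm_seq y @ \oo).

Lemma inv_taylor (m y : R) N : 0 < m -> 0 <= y ->
  m^-1 - (m + y)^-1 = \sum_(j < N) (-1) ^+ j * y ^+ j.+1 * m ^- j.+2
   + (-1) ^+ N * y ^+ N.+1 * (m ^- N.+1 * (m + y)^-1).
Proof.
move=> m0 y0; have my : m + y != 0 by rewrite gt_eqF// ltr_wpDr.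
have mn0 : m != 0 by rewrite gt_eqF.
elim: N => [|N IH].
  by rewrite big_ord0 expr0 !expr1; field; rewrite my.
rewrite IH big_ord_recr/= -addrA; congr (_ + _).
rewrite !exprS; set s := (-1) ^+ N; set p := y ^+ N.
have : m ^+ N != 0 by rewrite expf_neq0.
by set q := m ^+ N => q0; field; rewrite my q0 mn0.
Qed.

Lemma harm_seq_taylor y n N : 0 <= y ->
  `|harm_seq y n - \sum_(j < N) (-1) ^+ j * y ^+ j.+1 * zetap R n j.+2| <= 2 * y ^+ N.+1.
Proof.
move=> y0.
have -> : \sum_(j < N) (-1) ^+ j * y ^+ j.+1 * zetap R n j.+2 =
  \sum_(k < n) \sum_(j < N) (-1) ^+ j * y ^+ j.+1 * k.+1%:R ^- j.+2.
  by rewrite exchange_big; apply: eq_bigr => j _; rewrite /zetap mulr_sumr.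
rewrite -sumrB (le_trans (ler_norm_sum _ _ _))//.
have e : \sum_(k < n) y ^+ N.+1 * k.+1%:R ^- N.+2 = y ^+ N.+1 * zetap R n N.+2.
  by rewrite /zetap mulr_sumr.
apply: (@le_trans _ _ (y ^+ N.+1 * zetap R n N.+2)); last first.
  by rewrite mulrC; apply: ler_wpM2r; [exact: exprn_ge0|exact: zetap_le2].
rewrite -e; apply: ler_sum => k _.
have m0 : (0 : R) < k.+1%:R by rewrite ltr0n.
rewrite (inv_taylor N m0 y0) addrAC subrr add0r !normrM normrX normrN1 expr1n mul1r.
rewrite normrX (ger0_norm y0) ler_wpM2l ?exprn_ge0//.
rewrite !normfV normrX !gtr0_norm ?ltr_wpDr//.
rewrite [k.+1%:R ^+ N.+2]exprSr invfM ler_wpM2l ?invr_ge0 ?exprn_ge0//.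
by rewrite lef_pV2 ?posrE ?ltr_wpDr// lerDl.
Qed.

Lemma cvg_harm_seq y : 0 <= y -> harm_seq y @ \oo --> harm y.
Proof.
move=> y0; apply: nondecreasing_is_cvgn.
  apply/nondecreasing_seqP => n; rewrite /harm_seq big_ord_recr/= lerDl subr_ge0.
  have m0 : (0 : R) < n.+1%:R by rewrite ltr0n.
  by rewrite lef_pV2 ?posrE ?ltr_wpDr// lerDl.
exists (2 * y) => _ [n _ <-].
have := harm_seq_taylor n 0 y0; rewrite big_ord0 subr0 expr1.
by apply: le_trans; exact: ler_norm.
Qed.

Lemma harm_taylor y N : 0 <= y ->
  `|harm y - \sum_(j < N) (-1) ^+ j * y ^+ j.+1 * zeta j.+2%:R| <= 2 * y ^+ N.+1.
Proof.
move=> y0.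
apply: (@cvg_norm_le R (fun n => harm_seq y n - \sum_(j < N) (-1) ^+ j * y ^+ j.+1 * zetap R n j.+2)
  (fun=> 2 * y ^+ N.+1)).
- apply: cvgB; first exact: cvg_harm_seq.
  apply: (@cvg_sumr _ _ _ (fun (j : 'I_N) n => _ * zetap R n j.+2)) => j.
  by apply: cvgM; [exact: cvg_cst|exact: cvg_zetap].
- exact: cvg_cst.
by move=> n; exact: harm_seq_taylor.
Qed.

Lemma harm0 : harm 0 = 0.
Proof.
apply/eqP; rewrite -normr_eq0 eq_le normr_ge0 andbT.
by have := harm_taylor 0 (lexx (0 : R)); rewrite big_ord0 subr0 expr0n mulr0.
Qed.

Lemma harm_le2 x : 0 <= x <= 1 -> `|harm x| <= 2.
Proof.
move=> /andP[x0 x1]; have := harm_taylor 0 x0; rewrite big_ord0 subr0 expr1 => h.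
by apply: le_trans h _; rewrite ler_piMr.
Qed.

(** The function g with mu(g) = K(b, 0). *)
Definition inv_sum (b : nat) x : R := \sum_(1 <= n < b) (n%:R + x)^-1.

(** The multiplication formula for the partial sums, which is a regrouping of
    1/(m + x) over b <= m < b (N + 1) according to the residue of m. *)
Lemma harm_seq_mult (b : nat) x N : (0 < b)%N -> 0 <= x ->
  b%:R^-1 * \sum_(1 <= d < b) harm_seq ((d%:R + x) / b%:R) N + b%:R^-1 * harm_seq (x / b%:R) N =
  harm_seq x (b * N.+1).-1 + inv_sum b x + (euler_seq R N - euler_seq R (b * N.+1).-1 - ln b%:R).
Proof.
move=> b0 x0.
have bn0 : b%:R != 0 :> R by rewrite pnatr_eq0 -lt0n.
(* M + 1 = b (N + 1), so that the logarithms in the two Euler sequences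
   differ by exactly ln b. *)
set M := (b * N.+1).-1.
have M1 : M.+1 = (b * N.+1)%N by rewrite /M prednK// muln_gt0 b0.
have -> : b%:R^-1 * \sum_(1 <= d < b) harm_seq ((d%:R + x) / b%:R) N + b%:R^-1 * harm_seq (x / b%:R) N
  = b%:R^-1 * \sum_(0 <= d < b) harm_seq ((d%:R + x) / b%:R) N.
  by rewrite [in RHS]big_ltn// add0r mulrDr addrC.
have e1 : b%:R^-1 * \sum_(0 <= d < b) harm_seq ((d%:R + x) / b%:R) N =
   \sum_(k < N) k.+1%:R^-1 - \sum_(b * 1 <= m < b * N.+1) (m%:R + x)^-1.
  rewrite big_nat_mul_block// big_add1 big_mkord -sumrB /harm_seq exchange_big mulr_sumr.
  apply: eq_bigr => k _.
  rewrite sumrB sumr_const_nat subn0 -[_^-1 *+ b]mulr_natl mulrBr mulKf//; congr (_ - _).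
  rewrite mulr_sumr; apply: eq_bigr => d _.
  rewrite natrD natrM -invfM; congr (_^-1).
  by rewrite mulrDr mulrCA divff// mulr1 addrA.
have e2 : harm_seq x M + inv_sum b x =
   \sum_(k < M) k.+1%:R^-1 - \sum_(b * 1 <= m < b * N.+1) (m%:R + x)^-1.
  rewrite /harm_seq sumrB -addrA; congr (_ + _).
  have -> : \sum_(i < M) (i.+1%:R + x)^-1 = \sum_(1 <= m < b * N.+1) (m%:R + x)^-1.
    by rewrite -M1 big_add1 big_mkord.
  rewrite (@big_cat_nat _ _ _ (b * 1)%N 1 (b * N.+1))/= ?muln1// ?leq_pmulr//.
  by rewrite -/(inv_sum b x) opprD addrAC addNr add0r.
rewrite e1 e2 !euler_seqE M1 natrM lnM ?posrE ?ltr0n//; ring.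
Qed.

Lemma transfer_harm (b : nat) x : (2 <= b)%N -> 0 <= x ->
  transfer b harm x = harm x + inv_sum b x - ln b%:R - b%:R^-1 * harm (x / b%:R).
Proof.
move=> b2 x0; have b0 : (0 < b)%N by exact: ltnW.
have c1 : (fun N => b%:R^-1 * \sum_(1 <= d < b) harm_seq ((d%:R + x) / b%:R) N
    + b%:R^-1 * harm_seq (x / b%:R) N) @ \oo --> transfer b harm x + b%:R^-1 * harm (x / b%:R).
  apply: cvgD; last first.
    by apply: cvgM; [exact: cvg_cst|apply: cvg_harm_seq; rewrite divr_ge0].
  apply: cvgM; first exact: cvg_cst.
  apply: (@cvg_sumr _ _ _ (fun d N => harm_seq ((d%:R + x) / b%:R) N)) => d.
  by apply: cvg_harm_seq; rewrite divr_ge0 ?addr_ge0.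
pose f N := (b * N.+1).-1.
have nf n : (n <= f n)%N by rewrite /f -ltnS prednK ?muln_gt0 ?b0// leq_pmull.
have c2 : (fun N => harm_seq x (f N) + inv_sum b x + (euler_seq R N - euler_seq R (f N) - ln b%:R))
   @ \oo --> harm x + inv_sum b x + (euler_gamma R - euler_gamma R - ln b%:R).
  apply: cvgD.
    apply: cvgD; last exact: cvg_cst.
    by apply: (cvg_subseq nf); exact: cvg_harm_seq.
  apply: cvgB; last exact: cvg_cst.
  apply: cvgB; first exact: cvg_euler_seq.
  by apply: (cvg_subseq nf); exact: cvg_euler_seq.
have e : transfer b harm x + b%:R^-1 * harm (x / b%:R) =
    harm x + inv_sum b x + (euler_gamma R - euler_gamma R - ln b%:R).
  apply: (cvg_unique _ c1) => //; move: c2; apply: cvg_trans.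
  by apply: near_eq_cvg; apply: nearW => N; rewrite -harm_seq_mult.
by apply: (addIr (b%:R^-1 * harm (x / b%:R))); rewrite e; ring.
Qed.

End Harmonic.

(** * The sum over zero-free integers *)

Lemma digits_cons (b q d : nat) : (2 <= b)%N -> (0 < q)%N -> (d < b)%N ->
  digits b (b * q + d) = d :: digits b q.
Proof.
move=> b2 q0 db; have b0 : (0 < b)%N by exact: ltnW.
rewrite /digits.
have -> : trunc_log b (b * q + d) = (trunc_log b q).+1.
  have /andP[h1 h2] := trunc_log_bounds b2 q0.
  apply: trunc_log_eq => //; rewrite !expnS; apply/andP; split.
    by rewrite (leq_trans _ (leq_addr _ _))// leq_mul2l h1 orbT.
  apply: (@leq_trans (b * q.+1)%N); first by rewrite mulnS addnC ltn_add2r.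
  by rewrite -expnS leq_mul2l h2 orbT.
have -> : iota 0 (trunc_log b q).+2 = 0%N :: map S (iota 0 (trunc_log b q).+1).
  by rewrite -(iotaDl 1 0).
rewrite map_cons expn0 divn1 mulnC modnMDl modn_small//; congr (_ :: _).
rewrite -map_comp; apply: eq_map => k /=.
by rewrite expnS divnMA divnMDl// (divn_small db) addn0.
Qed.

Lemma digits_small (b m : nat) : (0 < m)%N -> (m < b)%N -> digits b m = [:: m].
Proof.
move=> m0 mb; have b1 : (1 < b)%N by exact: leq_ltn_trans mb.
rewrite /digits (_ : trunc_log b m = 0%N) /=; last first.
  by apply: trunc_log_eq => //; rewrite expn0 expn1 m0.
by rewrite expn0 divn1 modn_small.
Qed.

Section Kempner.
Variables (R : realType) (b : nat).
Hypothesis b2 : (2 <= b)%N.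
Let b0 : (0 < b)%N := ltnW b2.

(** The sum of F over the zero-free integers with l + 1 digits. *)
Definition level (l : nat) (F : nat -> R) : R :=
  \sum_(b ^ l <= m < b ^ l.+1 | 0 \notin digits b m) F m.

Lemma level0 F : level 0 F = \sum_(1 <= m < b) F m.
Proof.
rewrite /level expn0 expn1 big_nat_cond [RHS]big_nat_cond; apply: eq_bigl => m.
have [/andP[m0 mb]|] := boolP (1 <= m < b)%N; last by [].
by rewrite digits_small// inE eq_sym -lt0n m0.
Qed.

Lemma levelS l F :
  level l.+1 F = level l (fun q => \sum_(1 <= d < b) F (b * q + d)%N).
Proof.
rewrite /level big_mkcond/= (expnS b l) (expnS b l.+1) big_nat_mul_block; last first.
  by rewrite expnS leq_pmull.
rewrite [RHS]big_mkcond/= -expnS.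
apply: eq_big_nat => q /andP[q1 _].
have q0 : (0 < q)%N by apply: leq_trans q1; rewrite expn_gt0 b0.
rewrite big_ltn// addn0.
have := digits_cons b2 q0 b0; rewrite addn0 => ->; rewrite inE eqxx/= add0r.
case: ifPn => q0d; last first.
  apply: big1_seq => d /= ; rewrite mem_index_iota => /andP[d1 db].
  by rewrite digits_cons// inE negb_or (negbTE q0d) andbF.
apply: eq_big_nat => d /andP[d1 db].
by rewrite digits_cons// inE negb_or q0d andbT eq_sym -lt0n d1.
Qed.

Lemma transfer_inv (q : nat) :
  transfer b (fun x : R => (q%:R + x)^-1) =
  fun x => \sum_(d <- index_iota 1 b) 1 * ((b * q + d)%:R + x)^-1.
Proof.
have bn0 : b%:R != 0 :> R by rewrite pnatr_eq0 -lt0n.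
apply/funext => x; rewrite /transfer mulr_sumr; apply: eq_bigr => d _.
rewrite mul1r -invfM; congr (_^-1).
by rewrite natrD natrM mulrDr mulrCA divff// mulr1 addrA.
Qed.

(** Summing 1/(b q + d + x) over the nonzero last digits d gives the image of
    1/(q + x) under the transfer operator; repeating this removes all the
    digits but the leading one. *)
Lemma level_iter l j :
  level l (fun m => iter j (transfer b) (fun x : R => (m%:R + x)^-1) 0) =
  iter (l + j) (transfer b) (inv_sum b) 0.
Proof.
elim: l j => [|l IH] j.
  rewrite level0 add0n.
  have -> : inv_sum b = fun x : R => \sum_(n <- index_iota 1 b) 1 * (n%:R + x)^-1.
    by apply/funext => x; apply: eq_bigr => n _; rewrite mul1r.
  by rewrite iter_transfer_sum; apply: eq_bigr => n _; rewrite mul1r.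
rewrite levelS addSnnS -IH; apply: eq_bigr => q _.
rewrite iterSr transfer_inv iter_transfer_sum.
by apply: eq_bigr => d _; rewrite mul1r.
Qed.

Definition K_partial n : R := \sum_(1 <= m < n | 0 \notin digits b m) m%:R^-1.

Lemma K_partial_exp L : K_partial (b ^ L) = kmass b L (inv_sum b).
Proof.
elim: L => [|L IH]; first by rewrite /K_partial /kmass expn0 big_geq// big_ord0.
rewrite kmassSr -IH /K_partial (@big_cat_nat _ _ _ (b ^ L)%N) ?expn_gt0 ?b0//=; last first.
  by rewrite leq_exp2l.
congr (_ + _); rewrite -[L in RHS]addn0 -level_iter /level; apply: eq_bigr => m _.
by rewrite /= addr0.
Qed.

Lemma cvg_K : (fun L => kmass b L (inv_sum b)) @ \oo --> (K b 0 : R).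
Proof.
have nd : nondecreasing_seq K_partial.
  apply/nondecreasing_seqP => -[|n]; first by rewrite /K_partial !big_geq.
  rewrite /K_partial big_mkcond [leRHS]big_mkcond [leRHS]big_nat_recr//= lerDl.
  by case: ifP => // _; rewrite invr_ge0.
have bn n : (n <= b ^ n)%N by exact/ltnW/ltn_expl.
have cv : cvgn K_partial.
  apply: nondecreasing_is_cvgn => //; exists (b%:R * b%:R) => _ [n _ <-].
  apply: (le_trans (nd _ _ (bn n))); rewrite K_partial_exp.
  apply: (@le_trans _ _ (b%:R * kmass b n (fun=> 1 : R))); last first.
    by rewrite ler_wpM2l// kmass1_le.
  rewrite -kmassZ; apply: kmass_le => // x /andP[x0 _]; rewrite mulr1 /inv_sum.
  apply: (@le_trans _ _ (\sum_(1 <= n < b) (1 : R))).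
    apply: ler_sum_nat => d /andP[d1 _]; rewrite invf_le1 ?ltr_wpDr ?ltr0n//.
    by rewrite ler_wpDr// ler1n.
  by rewrite sumr_const_nat ler_nat leq_subr.
(* The partial sums of the series are sampled at the powers of b. *)
have := cvg_subseq bn cv.
rewrite (_ : K_partial \o _ = fun L => kmass b L (inv_sum b))//.
by apply/funext => L /=; rewrite K_partial_exp.
Qed.

(** The moments v_k = mu(x^k)/b of the normalized measure. *)
Definition mom k : R := kmom R b k / b%:R.

Lemma mom0 : mom 0 = 1.
Proof. by rewrite /mom kmom0// divff// pnatr_eq0 -lt0n. Qed.

Lemma mom_bound k : 0 <= mom k <= 1.
Proof.
have bp : (0 : R) < b%:R by rewrite ltr0n.
apply/andP; split.
  rewrite divr_ge0//; apply: (ler_cvg_to (cvg_cst 0) (@cvg_kmom R b b2 k)).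
  apply: nearW => L; apply: le_trans (normr_ge0 (kmass b L (fun x : R => x ^+ k))) _.
  apply: kmass_norm_le => // x /andP[x0 _].
  by rewrite ger0_norm ?exprn_ge0.
rewrite ler_pdivrMr// mul1r -(@kmom0 R b b2).
apply: (ler_cvg_to (@cvg_kmom R b b2 k) (@cvg_kmom R b b2 0)).
apply: nearW => L; apply: kmass_le => // x /andP[x0 x1].
by rewrite expr0 exprn_ile1.
Qed.

Lemma mom_rec k : mom k.+1 =
  \sum_(j < k.+2) (b%:R ^- k.+2 * ('C(k.+1, j)%:R * power_sum R b (k.+1 - j))) * mom j.
Proof.
by rewrite /mom kmom_rec// mulr_suml; apply: eq_bigr => j _; rewrite -[LHS]mulrA.
Qed.

(** The multiplication formula integrated over the strings of fewer than L
    digits; the last term is what the truncation adds. *)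
Lemma kmass_inv_sum L : kmass b L (inv_sum b) =
  ln b%:R * kmass b L (fun=> 1 : R)
  + b%:R^-1 * kmass b L (fun x : R => harm (x / b%:R)) + iter L (transfer b) (@harm R) 0.
Proof.
have := kmassS b L (@harm R); rewrite kmassSr harm0 add0r => h.
have e : kmass b L (transfer b (@harm R)) = kmass b L (@harm R) + kmass b L (inv_sum b)
   - ln b%:R * kmass b L (fun=> 1 : R) - b%:R^-1 * kmass b L (fun x : R => harm (x / b%:R)).
  rewrite -!kmassZ -kmassD -!kmassB; apply: kmass_eq => // x /andP[x0 _].
  by rewrite transfer_harm// mulr1.
move: h; rewrite e => h; set k1 := kmass b L (inv_sum b).
apply: (addrI (kmass b L (@harm R))); rewrite 2!addrA; move: h => /(canRL (addrK _)); rewrite -/k1.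
lra.
Qed.

(** The Taylor expansion of h(x/b) inserted into K(b, 0) = b ln b + (1/b) mu(h(x/b)). *)
Lemma K_expansion N :
  `|K b 0 - b%:R * ln b%:R
    - \sum_(j < N) (-1) ^+ j * zeta j.+2%:R * b%:R ^- j.+1 * mom j.+1| <= 2 * b%:R ^- N.+1.
Proof.
have bp : (0 : R) < b%:R by rewrite ltr0n.
have bn0 : b%:R != 0 :> R by rewrite gt_eqF.
pose c (j : 'I_N) : R := (-1) ^+ j * zeta j.+2%:R * b%:R ^- j.+1.
have h1 L : `|kmass b L (fun x : R => harm (x / b%:R)) -
    \sum_(j < N) c j * kmass b L (fun x : R => x ^+ j.+1)| <= 2 * b%:R ^- N.+1 * kmass b L (fun=> 1 : R).
  rewrite -kmass_sum -kmassB -kmassZ; apply: kmass_norm_le => // x /andP[x0 x1].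
  have y0 : 0 <= x / b%:R by rewrite divr_ge0.
  rewrite mulr1; have := harm_taylor N y0.
  rewrite (eq_bigr (fun j : 'I_N => c j * x ^+ j.+1)); last first.
    by move=> j _; rewrite /c expr_div_n; ring.
  move/le_trans; apply; rewrite expr_div_n ler_wpM2l// ler_piMl ?invr_ge0 ?exprn_ge0//.
  by rewrite exprn_ile1.
pose u L := kmass b L (inv_sum b) - ln b%:R * kmass b L (fun=> 1 : R) -
  iter L (transfer b) (@harm R) 0
  - b%:R^-1 * \sum_(j < N) c j * kmass b L (fun x : R => x ^+ j.+1).
have hu L : `|u L| <= b%:R^-1 * (2 * b%:R ^- N.+1 * kmass b L (fun=> 1 : R)).
  have -> : u L = b%:R^-1 * (kmass b L (fun x : R => harm (x / b%:R)) -
    \sum_(j < N) c j * kmass b L (fun x : R => x ^+ j.+1)).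
    by rewrite /u kmass_inv_sum; ring.
  by rewrite normrM gtr0_norm ?invr_gt0// ler_wpM2l ?invr_ge0// ltW.
have ul : u @ \oo --> K b 0 - ln b%:R * b%:R - 0 - b%:R^-1 * \sum_(j < N) c j * kmom R b j.+1.
  apply: cvgB.
    apply: cvgB; last by apply: (@iter_transfer_cvg0 R b b2 _ 2) => x; exact: harm_le2.
    apply: cvgB; first exact: cvg_K.
    by apply: cvgM; [exact: cvg_cst|exact: cvg_kmass1].
  apply: cvgM; first exact: cvg_cst.
  apply: (@cvg_sumr _ _ _ (fun (j : 'I_N) L => c j * kmass b L (fun x : R => x ^+ j.+1))) => j.
  by apply: cvgM; [exact: cvg_cst|exact: cvg_kmom].
have vl : (fun L => b%:R^-1 * (2 * b%:R ^- N.+1 * kmass b L (fun=> 1 : R))) @ \oo -->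
   (b%:R^-1 * (2 * b%:R ^- N.+1 * b%:R) : R).
  by apply: cvgM; [exact: cvg_cst|apply: cvgM; [exact: cvg_cst|exact: cvg_kmass1]].
have := cvg_norm_le ul vl hu.
rewrite [X in _ <= X](_ : _ = 2 * b%:R ^- N.+1); last by rewrite mulrC mulfK.
rewrite subr0 (mulrC (ln _)) mulr_sumr.
rewrite (eq_bigr (fun j : 'I_N => (-1) ^+ j * zeta j.+2%:R * b%:R ^- j.+1 * mom j.+1))//.
by move=> j _; rewrite /c /mom; ring.
Qed.

End Kempner.

(** * Asymptotic expansions in inverse powers *)

Section Expansions.
Variable R : realType.
Implicit Types (f g v r e : nat -> R) (P Q D : {poly R}) (N n : nat).

(** f(b) = P(1/b) + O(b^-N), with a constant valid from b = 2 on. *)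
Definition approx N f P := exists C : R, forall b, (2 <= b)%N ->
  `|f b - P.[b%:R^-1]| <= C * b%:R ^- N.

(** Existence, for each order N separately, of a polynomial in 1/b that
    approximates f up to O(b^-N).  Terms of degree N and higher are allowed, so
    that closure under products needs no truncation. *)
Definition expandable f := forall N, exists P, approx N f P.

Lemma eq_upto_bound N f g (C : R) :
  (forall b, (2 <= b)%N -> `|f b - g b| <= C * b%:R ^- N) -> eq_upto_inv_pow N f g.
Proof.
move=> h; rewrite /eq_upto_inv_pow; apply/eqaddOP; near=> k; near=> b.
have b2 : (2 <= b)%N by near: b; exact: nbhs_infty_ge.
apply: (le_trans (h b b2)).
have p0 : 0 <= b%:R ^- N :> R by rewrite invr_ge0 exprn_ge0.
rewrite [`|b%:R ^- N|]ger0_norm// ler_wpM2r//.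
Unshelve. all: by end_near.
Qed.

Lemma invn_itv b : (2 <= b)%N -> 0 < (b%:R^-1 : R) <= 2^-1.
Proof.
move=> b2; have b0 : (0 : R) < b%:R by rewrite ltr0n ltnW.
by rewrite invr_gt0 b0 lef_pV2 ?posrE// ler_nat.
Qed.

Lemma horner_bound P : exists2 C : R, 0 <= C &
  forall b, (2 <= b)%N -> `|P.[b%:R^-1]| <= C.
Proof.
exists (\sum_(i < size P) `|P`_i|); first by apply: sumr_ge0.
move=> b /invn_itv/andP[t0 t1].
rewrite horner_coef (le_trans (ler_norm_sum _ _ _))//; apply: ler_sum => i _.
rewrite normrM ler_piMr// normrX ger0_norm ?(ltW t0)// exprn_ile1 ?(ltW t0)//; lra.
Qed.

Lemma approx_bounded N f P : approx N f P ->
  exists2 C : R, 0 <= C & forall b, (2 <= b)%N -> `|f b| <= C.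
Proof.
move=> [C h]; have [C' C'0 h'] := horner_bound P.
exists (`|C| + C'); first by rewrite addr_ge0.
move=> b b2; rewrite -(subrK P.[b%:R^-1] (f b)) (le_trans (ler_normD _ _))//.
rewrite lerD ?h'// (le_trans (h b b2))//.
have /andP[t0 t1] := invn_itv b2.
rewrite -exprVn (@le_trans _ _ (`|C| * b%:R^-1 ^+ N))//.
  by rewrite ler_wpM2r ?ler_norm// exprn_ge0// ltW.
by rewrite ler_piMr// exprn_ile1 ?(ltW t0)//; lra.
Qed.

Lemma approx_leq M N f P : (M <= N)%N -> approx N f P -> approx M f P.
Proof.
move=> MN [C h]; exists `|C| => b b2; apply: (le_trans (h b b2)).
have /andP[t0 t1] := invn_itv b2; rewrite -!exprVn.
apply: (@le_trans _ _ (`|C| * b%:R^-1 ^+ N)).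
  by rewrite ler_wpM2r ?ler_norm// exprn_ge0// ltW.
by rewrite ler_wpM2l// ler_wiXn2l// ?(ltW t0)//; lra.
Qed.

Lemma expandable_eq f g : (forall b, (2 <= b)%N -> f b = g b) -> expandable f -> expandable g.
Proof. by move=> fg h N; have [P [C k]] := h N; exists P, C => b b2; rewrite -fg ?k. Qed.

Lemma expandable_cst c : expandable (fun=> c).
Proof.
by move=> N; exists c%:P, 0 => b _; rewrite hornerC subrr normr0 mul0r.
Qed.

Lemma expandable_inv : expandable (fun b => b%:R^-1).
Proof. by move=> N; exists 'X, 0 => b _; rewrite hornerX subrr normr0 mul0r. Qed.

Lemma expandableD f g : expandable f -> expandable g -> expandable (fun b => f b + g b).
Proof.
move=> hf hg N; have [P [C h]] := hf N; have [Q [C' h']] := hg N.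
exists (P + Q), (C + C') => b b2; rewrite hornerD mulrDl.
by rewrite opprD addrACA (le_trans (ler_normD _ _))// lerD ?h ?h'.
Qed.

Lemma expandableM f g : expandable f -> expandable g -> expandable (fun b => f b * g b).
Proof.
move=> hf hg N; have [P hP] := hf N; have [Q hQ] := hg N.
have [B B0 hB] := approx_bounded hQ; have [B' B'0 hB'] := horner_bound P.
case: hP => C h; case: hQ => C' h'.
exists (P * Q), (C * B + B' * C') => b b2; rewrite hornerM.
have -> : f b * g b - P.[b%:R^-1] * Q.[b%:R^-1] =
  (f b - P.[b%:R^-1]) * g b + P.[b%:R^-1] * (g b - Q.[b%:R^-1]) by ring.
rewrite (le_trans (ler_normD _ _))// !normrM mulrDl lerD//.
  by rewrite mulrAC ler_pM ?h ?hB.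
by rewrite -mulrA ler_pM ?h' ?hB'.
Qed.

Lemma expandable_sum (I : Type) (r : seq I) (f : I -> nat -> R) :
  (forall i, expandable (f i)) -> expandable (fun b => \sum_(i <- r) f i b).
Proof.
move=> h; elim: r => [|i r IH].
  by apply: (expandable_eq _ (expandable_cst 0)) => b _; rewrite big_nil.
by apply: (expandable_eq _ (expandableD (h i) IH)) => b _; rewrite big_cons.
Qed.

Lemma expandableX f k : expandable f -> expandable (fun b => f b ^+ k).
Proof.
move=> h; elim: k => [|k IH]; first exact: expandable_cst.
by apply: (expandable_eq _ (expandableM h IH)) => b _; rewrite exprS.
Qed.

(** A bounded solution of v = r + (1/b) e v is expandable if r and e are: each
    substitution of an approximation of v into the right-hand side gains one
    order. *)
Lemma expandable_fix v r e (C : R) :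
  (forall b, (2 <= b)%N -> `|v b| <= C) ->
  (forall b, (2 <= b)%N -> v b = r b + b%:R^-1 * e b * v b) ->
  expandable r -> expandable e -> expandable v.
Proof.
move=> vC ve hr he; elim=> [|N [P [B hP]]].
  by exists 0, C => b b2; rewrite hornerC subr0 expr0 invr1 mulr1 vC.
have [Q [A hQ]] := hr N.+1; have [E [D hE]] := he N.
have [G G0 hG] := horner_bound E.
exists (Q + 'X * E * P), (A + D * C + G * B) => b b2.
rewrite !hornerE {1}ve//; have /andP[t0 t1] := invn_itv b2.
set t := b%:R^-1 in t0 t1 *.
have -> : r b + t * e b * v b - (Q.[t] + t * E.[t] * P.[t]) =
  (r b - Q.[t]) + t * ((e b - E.[t]) * v b) + t * (E.[t] * (v b - P.[t])) by ring.
have -> : (A + D * C + G * B) * b%:R ^- N.+1 =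
  A * b%:R ^- N.+1 + D * C * b%:R ^- N.+1 + G * B * b%:R ^- N.+1 by ring.
rewrite (le_trans (ler_normD _ _))// lerD//.
  rewrite (le_trans (ler_normD _ _))// lerD ?hQ//.
  rewrite !normrM (gtr0_norm t0) -exprVn exprS -/t.
  have -> : D * C * (t * t ^+ N) = t * (D * t ^+ N * C) by ring.
  by rewrite ler_wpM2l ?(ltW t0)// ler_pM ?vC// exprVn hE.
rewrite !normrM (gtr0_norm t0) -exprVn exprS -/t.
have -> : G * B * (t * t ^+ N) = t * (G * (B * t ^+ N)) by ring.
by rewrite ler_wpM2l ?(ltW t0)// ler_pM ?hG// exprVn hP.
Qed.

(** Uniqueness of the coefficients of an expansion. *)
Lemma horner_inv_eq0 D n (C : R) :
  (forall b, (2 <= b)%N -> `|D.[b%:R^-1]| <= C * b%:R ^- n) ->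
  forall i, (i < n)%N -> D`_i = 0.
Proof.
elim: n D => [//|n IH] D; elim/poly_ind: D => [|Q c _] h i ilt; first by rewrite coef0.
have [B B0 hB] := horner_bound Q.
(* The constant coefficient c is O(1/b). *)
have c0 : c = 0.
  apply/eqP; rewrite -normr_eq0 eq_le normr_ge0 andbT.
  have l : (fun n : nat => (`|C| + B) * n.+2%:R^-1) @ \oo --> ((`|C| + B) * 0 : R).
    by apply: cvgM; [exact: cvg_cst|exact: cvg_invn2].
  rewrite mulr0 in l; apply: (cvg_norm_le (cvg_cst c) l) => m.
  have /andP[t0 t1] := @invn_itv m.+2 isT.
  have := h m.+2 isT; rewrite !hornerE; have := hB m.+2 isT.
  rewrite -exprVn; set t := m.+2%:R^-1 in t0 t1 *; move=> hq hh.
  have -> : c = (Q.[t] * t + c) - Q.[t] * t by ring.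
  rewrite (le_trans (ler_normB _ _))// mulrDl lerD//.
    apply: (le_trans hh); rewrite exprS mulrCA mulrA [t * C]mulrC.
    apply: (@le_trans _ _ (`|C| * t * t ^+ n)).
      by rewrite ler_wpM2r ?exprn_ge0 ?(ltW t0)// ler_wpM2r ?ler_norm// ltW.
    rewrite ler_piMr ?mulr_ge0 ?(ltW t0)// exprn_ile1 ?(ltW t0)//; lra.
  by rewrite normrM (gtr0_norm t0) ler_wpM2r// ltW.
rewrite coefD coefMX coefC c0; case: i ilt => [|i] ilt; first by rewrite addr0.
rewrite /= addr0; apply: (IH Q) => // b b2.
have := h b b2; rewrite !hornerE c0 addr0 normrM.
have /andP[t0 t1] := invn_itv b2.
by rewrite (gtr0_norm t0) -!exprVn exprSr mulrA ler_pM2r.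
Qed.

(** By uniqueness, the approximating polynomials of different orders have the
    same low coefficients, which form the sequence of the expansion. *)
Lemma expandable_expansion f : expandable f -> exists a, asymptotic_expansion_inv f a.
Proof.
move=> /choice[P hP].
(* Both polynomials approximate f up to O(b^-(n + 1)). *)
have coefP n N : (n < N)%N -> (P N)`_n = (P n.+1)`_n.
  move=> nN; have [C h] := approx_leq nN (hP N); have [C' h'] := hP n.+1.
  apply/eqP; rewrite -subr_eq0 -coefB; apply/eqP.
  apply: (@horner_inv_eq0 _ n.+1 (C' + C)) => // b b2; rewrite hornerD hornerN mulrDl.
  have -> : (P N).[b%:R^-1] - (P n.+1).[b%:R^-1] =
    (f b - (P n.+1).[b%:R^-1]) - (f b - (P N).[b%:R^-1]) by ring.
  by rewrite (le_trans (ler_normB _ _))// lerD ?h ?h'.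
exists (fun n => (P n.+1)`_n) => N.
have [C h] := hP N.+1; have [B B0 hB] := horner_bound (drop_poly N.+1 (P N.+1)).
apply: (@eq_upto_bound _ _ _ (C + B)) => b b2.
have -> : \sum_(n < N.+1) (P n.+1)`_n * b%:R ^- n = (take_poly N.+1 (P N.+1)).[b%:R^-1].
  rewrite horner_poly; apply: eq_bigr => n _.
  by rewrite (coefP _ _ (ltn_ord n)) exprVn.
have := h b b2; rewrite -[in (P N.+1).[_]](poly_take_drop N.+1 (P N.+1)) => hh.
rewrite hornerD hornerM hornerXn exprVn in hh.
set u := (take_poly _ _).[_] in hh *; set w := (drop_poly _ _).[_] in hh *.
have -> : f b - u = (f b - (u + w * b%:R ^- N.+1)) + w * b%:R ^- N.+1 by ring.
rewrite (le_trans (ler_normD _ _))// mulrDl lerD// normrM.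
have p0 : 0 <= b%:R ^- N.+1 :> R by rewrite invr_ge0 exprn_ge0.
by rewrite (ger0_norm p0) ler_wpM2r// hB.
Qed.

End Expansions.

(** * Power sums and moments *)

Section Moments.
Variable R : realType.
Implicit Types (p k b : nat).

(** The quotient S_p(b)/b^(p+1), where S_p(b) is the sum of the p-th powers
    below b. *)
Definition scaled_sum p b : R := b%:R ^- p.+1 * power_sum R b p.

(** Telescoping of (d + 1)^(p+1) - d^(p+1). *)
Lemma sum_bin_power p b : (0 < b)%N ->
  \sum_(j < p.+1) 'C(p.+1, j)%:R * power_sum R b j = b%:R ^+ p.+1 - 1.
Proof.
case: b => // b _.
have -> : b.+1%:R ^+ p.+1 - 1 = \sum_(1 <= d < b.+1) ((d.+1)%:R ^+ p.+1 - d%:R ^+ p.+1) :> R.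
  by rewrite telescope_sumr// expr1n.
rewrite /power_sum; under eq_bigr do rewrite mulr_sumr.
rewrite exchange_big; apply: eq_bigr => d _.
rewrite -[d.+1%:R]natr1 (addrC d%:R) exprDn [in RHS]big_ord_recr/= binn mulr1n subnn expr0 mul1r addrK.
by apply: eq_bigr => j _; rewrite expr1n mul1r mulr_natl.
Qed.

Lemma scaled_sum_rec p b : (2 <= b)%N ->
  scaled_sum p b = p.+1%:R^-1 * (1 - b%:R^-1 ^+ p.+1
    - \sum_(j < p) 'C(p.+1, j)%:R * b%:R^-1 ^+ (p - j) * scaled_sum j b).
Proof.
move=> b2; have b0 : b%:R != 0 :> R by rewrite pnatr_eq0 -lt0n ltnW.
have := sum_bin_power p (ltnW b2); rewrite big_ord_recr/= binSn => /(congr1 (fun z => b%:R ^- p.+1 * z)).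
rewrite mulrDr mulr_sumr mulrBr mulr1 mulVf ?expf_neq0// -exprVn => h.
have e : \sum_(j < p) 'C(p.+1, j)%:R * b%:R^-1 ^+ (p - j) * scaled_sum j b =
  \sum_(j < p) b%:R^-1 ^+ p.+1 * ('C(p.+1, j)%:R * power_sum R b j).
  apply: eq_bigr => j _; rewrite /scaled_sum -exprVn.
  have -> : b%:R^-1 ^+ p.+1 = b%:R^-1 ^+ (p - j) * b%:R^-1 ^+ j.+1 :> R.
    by rewrite -exprD addnS subnK// ltnW.
  ring.
by rewrite e -h [X in _ * X]addrC addKr /scaled_sum -exprVn (mulrCA (_ ^+ _)) mulKf//.
Qed.

Lemma expandable_scaled_sum p : expandable (scaled_sum p).
Proof.
elim/ltn_ind: p => p IH.
apply: (@expandable_eq _ (fun b => p.+1%:R^-1 * (1 + -1 * b%:R^-1 ^+ p.+1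
    + -1 * \sum_(j < p) 'C(p.+1, j)%:R * b%:R^-1 ^+ (p - j) * scaled_sum j b))).
  by move=> b b2; rewrite scaled_sum_rec// !mulN1r.
apply: expandableM; first exact: expandable_cst.
apply: expandableD.
  apply: expandableD; first exact: expandable_cst.
  apply: expandableM; first exact: expandable_cst.
  by apply: expandableX; exact: expandable_inv.
apply: expandableM; first exact: expandable_cst.
apply: (@expandable_sum _ _ _ (fun (j : 'I_p) b => _ * scaled_sum j b)) => j.
apply: expandableM; last exact: IH.
apply: expandableM; first exact: expandable_cst.
by apply: expandableX; exact: expandable_inv.
Qed.

Lemma mom_rec_scaled k b : (2 <= b)%N -> mom R b k.+1 =
  \sum_(j < k.+2) 'C(k.+1, j)%:R * b%:R^-1 ^+ j * scaled_sum (k.+1 - j) b * mom R b j.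
Proof.
move=> b2; rewrite mom_rec//; apply: eq_bigr => j _; congr (_ * _).
rewrite /scaled_sum -!exprVn.
have -> : b%:R^-1 ^+ k.+2 = b%:R^-1 ^+ j * b%:R^-1 ^+ (k.+1 - j).+1 :> R.
  by rewrite -exprD addnS subnKC// -ltnS.
ring.
Qed.

(** The recurrence is a fixed-point equation for v_(k+1), whose own coefficient
    on the right is b^-(k+1) S_0(b)/b. *)
Lemma expandable_mom k : expandable (fun b => mom R b k).
Proof.
elim/ltn_ind: k => -[|k] IH.
  by apply: (expandable_eq _ (expandable_cst 1)) => b b2; rewrite mom0.
pose r b := \sum_(j < k.+1) 'C(k.+1, j)%:R * b%:R^-1 ^+ j * scaled_sum (k.+1 - j) b * mom R b j.
pose e b := b%:R^-1 ^+ k * scaled_sum 0 b.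
apply: (@expandable_fix R (fun b => mom R b k.+1) r e 1).
- by move=> b b2; have /andP[m0 m1] := mom_bound R b2 k.+1; rewrite ger0_norm.
- move=> b b2; rewrite [LHS]mom_rec_scaled// big_ord_recr/= subnn binn mul1r exprS.
  by rewrite /r /e !mulrA.
- apply: (@expandable_sum _ _ _ (fun (j : 'I_k.+1) b => _ * mom R b j)) => j.
  apply: expandableM; last exact: IH.
  apply: expandableM; last exact: expandable_scaled_sum.
  apply: expandableM; first exact: expandable_cst.
  by apply: expandableX; exact: expandable_inv.
- apply: expandableM; last exact: expandable_scaled_sum.
  by apply: expandableX; exact: expandable_inv.
Qed.

Lemma expandable_K : expandable (fun b => K b 0 - b%:R * ln b%:R : R).
Proof.
move=> N.
pose s b := \sum_(j < N) (-1) ^+ j * zeta j.+2%:R * b%:R^-1 ^+ j.+1 * mom R b j.+1.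
have [P [C h]] : exists P, approx N s P.
  apply: (@expandable_sum _ _ _ (fun (j : 'I_N) b => _ * mom R b j.+1)) => j.
  apply: expandableM; last exact: expandable_mom.
  apply: expandableM; first exact: expandable_cst.
  by apply: expandableX; exact: expandable_inv.
exists P, (2 + C) => b b2.
set f := K b 0 - _.
have -> : f - P.[b%:R^-1] = (f - s b) + (s b - P.[b%:R^-1]) by ring.
rewrite (le_trans (ler_normD _ _))// mulrDl lerD ?h//.
have := @K_expansion R b b2 N.
rewrite (eq_bigr (fun j : 'I_N => (-1) ^+ j * zeta j.+2%:R * b%:R^-1 ^+ j.+1 * mom R b j.+1)); last first.
  by move=> j _; rewrite exprVn.
move/le_trans; apply; rewrite ler_wpM2l//.
have /andP[t0 t1] := invn_itv R b2; rewrite -!exprVn.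
by rewrite ler_wiXn2l// ?(ltW t0)//; lra.
Qed.

End Moments.

(** * The first moments *)

Section Bounded.
Variable R : realType.
Implicit Types (b : nat) (w u : nat -> R).

(** Boundedness on b >= 2, the range where K(b, 0) is meaningful. *)
Definition bnd w := exists C : R, forall b, (2 <= b)%N -> `|w b| <= C.

Lemma bnd_cst (c : R) : bnd (fun=> c).
Proof. by exists `|c|. Qed.

Lemma bnd_inv : bnd (fun b => b%:R^-1).
Proof.
exists 1 => b /(invn_itv R)/andP[t0 t1]; rewrite ger0_norm ?(ltW t0)//; lra.
Qed.

Lemma bndN w : bnd w -> bnd (fun b => - w b).
Proof. by move=> [C h]; exists C => b b2; rewrite normrN h. Qed.

Lemma bndD w u : bnd w -> bnd u -> bnd (fun b => w b + u b).
Proof.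
move=> [C h] [C' h']; exists (C + C') => b b2.
by rewrite (le_trans (ler_normD _ _))// lerD ?h ?h'.
Qed.

Lemma bndM w u : bnd w -> bnd u -> bnd (fun b => w b * u b).
Proof.
move=> [C h] [C' h']; exists (C * C') => b b2.
by rewrite normrM ler_pM ?h ?h'.
Qed.

Lemma bndX w n : bnd w -> bnd (fun b => w b ^+ n).
Proof.
by move=> [C h]; exists (C ^+ n) => b b2; rewrite normrX lerXn2r ?nnegrE ?h// (le_trans _ (h b b2)).
Qed.

Lemma bnd_mom k : bnd (fun b => mom R b k).
Proof.
exists 1 => b b2; have /andP[m0 m1] := mom_bound R b2 k.
by rewrite ger0_norm.
Qed.

End Bounded.

Ltac bnd_tac := repeat first [exact: bnd_cst | exact: bnd_inv | exact: bnd_mom | eassumption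
  | apply: bndD | apply: bndN | apply: bndM | apply: bndX].

Section Coefficients.
Variable R : realType.
Implicit Types (b : nat) (w u : nat -> R).

Lemma scaled_sum0 b : (2 <= b)%N -> scaled_sum R 0 b = 1 - b%:R^-1.
Proof. by move=> b2; rewrite scaled_sum_rec// big_ord0 invr1 mul1r subr0 expr1. Qed.

Let bin_vals : ('C(4, 2) = 6)%N * ('C(5, 2) = 10)%N * ('C(5, 3) = 10)%N *
  ('C(6, 2) = 15)%N * ('C(6, 3) = 20)%N * ('C(6, 4) = 15)%N.
Proof. by []. Qed.

Let binE := (bin0, bin1, binSn, bin_vals, subSS, subn0).

Lemma scaled_sum1 b : (2 <= b)%N -> scaled_sum R 1 b = (1 - b%:R^-1) / 2.
Proof.
move=> b2; rewrite scaled_sum_rec// !big_ord_recr big_ord0/= scaled_sum0// !binE.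
by set t := b%:R^-1; field.
Qed.

Lemma scaled_sum2 b : (2 <= b)%N ->
  scaled_sum R 2 b = (1 - b%:R^-1) * (2 - b%:R^-1) / 6.
Proof.
move=> b2; rewrite scaled_sum_rec// !big_ord_recr big_ord0/= scaled_sum0// scaled_sum1// !binE.
by set t := b%:R^-1; field.
Qed.

Lemma scaled_sum3 b : (2 <= b)%N ->
  scaled_sum R 3 b = (1 - b%:R^-1) ^+ 2 / 4.
Proof.
move=> b2; rewrite scaled_sum_rec// !big_ord_recr big_ord0/=.
rewrite scaled_sum0// scaled_sum1// scaled_sum2// !binE.
by set t := b%:R^-1; field.
Qed.

Lemma scaled_sum4 b : (2 <= b)%N -> let t := b%:R^-1 in
  scaled_sum R 4 b = 1 / 5 - t / 2 + t ^+ 2 / 3 - t ^+ 4 / 30.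
Proof.
move=> b2 t; rewrite scaled_sum_rec// !big_ord_recr big_ord0/=.
rewrite scaled_sum0// scaled_sum1// scaled_sum2// scaled_sum3// !binE -/t.
by field.
Qed.

Lemma scaled_sum5 b : (2 <= b)%N -> let t := b%:R^-1 in
  scaled_sum R 5 b = 1 / 6 - t / 2 + 5 * t ^+ 2 / 12 - t ^+ 4 / 12.
Proof.
move=> b2 t; rewrite scaled_sum_rec// !big_ord_recr big_ord0/=.
rewrite scaled_sum0// scaled_sum1// scaled_sum2// scaled_sum3// scaled_sum4// !binE -/t.
by field.
Qed.

(** To approximate v_(k+1) by c up to O(b^-m), it suffices to insert c into the
    recurrence: the coefficient of v_(k+1) is 1 - b^-(k+1) (1 - 1/b), which is at
    least 1/2. *)
Lemma mom_approx k m (c rho : nat -> R) : bnd rho ->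
  (forall b, (2 <= b)%N -> let t := b%:R^-1 in
    \sum_(j < k.+1) 'C(k.+1, j)%:R * t ^+ j * scaled_sum R (k.+1 - j) b * mom R b j =
    c b * (1 - t ^+ k.+1 * (1 - t)) + t ^+ m * rho b) ->
  exists2 w, bnd w & forall b, (2 <= b)%N -> mom R b k.+1 = c b + b%:R^-1 ^+ m * w b.
Proof.
move=> [C hC] h.
have den b : (2 <= b)%N -> 2^-1 <= 1 - (b%:R^-1 : R) ^+ k.+1 * (1 - b%:R^-1).
  move=> /(invn_itv R)/andP[]; set t := b%:R^-1 => t0 t1.
  have tk : t ^+ k.+1 <= 2^-1.
    by rewrite exprS (le_trans _ t1)// ler_piMr ?(ltW t0)// exprn_ile1 ?(ltW t0)//; lra.
  have tk0 : 0 <= t ^+ k.+1 by rewrite exprn_ge0// ltW.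
  nra.
exists (fun b => rho b / (1 - b%:R^-1 ^+ k.+1 * (1 - b%:R^-1))).
  exists (C * 2) => b b2; have d := den b b2.
  have d0 : 0 < 1 - (b%:R^-1 : R) ^+ k.+1 * (1 - b%:R^-1) by apply: lt_le_trans d; rewrite invr_gt0.
  by rewrite normrM normfV (gtr0_norm d0) ler_pM ?invr_ge0 ?(ltW d0) ?hC// invf_ple ?posrE.
move=> b b2; have dn0 : 1 - (b%:R^-1 : R) ^+ k.+1 * (1 - b%:R^-1) != 0.
  by rewrite gt_eqF// (lt_le_trans _ (den b b2))// invr_gt0.
have e : mom R b k.+1 * (1 - b%:R^-1 ^+ k.+1 * (1 - b%:R^-1)) =
   c b * (1 - b%:R^-1 ^+ k.+1 * (1 - b%:R^-1)) + b%:R^-1 ^+ m * rho b.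
  rewrite -h// mulrBr mulr1 {1}mom_rec_scaled// big_ord_recr/= subnn binn scaled_sum0//.
  ring.
by apply: (mulIf dn0); rewrite e mulrDl -mulrA divfK.
Qed.

Lemma mom1_approx : exists2 w, bnd w & forall b, (2 <= b)%N ->
  let t := b%:R^-1 in mom R b 1 = (1 / 2 - t ^+ 2 / 2 - t ^+ 3 / 2) + t ^+ 5 * w b.
Proof.
apply: (@mom_approx 0 5 _ (fun=> 1 / 2)); first exact: bnd_cst.
move=> b b2 t; rewrite big_ord_recr big_ord0/= binE mom0// subn0 scaled_sum1// -/t.
by field.
Qed.

Lemma mom2_approx : exists2 w, bnd w & forall b, (2 <= b)%N ->
  let t := b%:R^-1 in mom R b 2 = (1 / 3 - 5 / 6 * t ^+ 3) + t ^+ 5 * w b.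
Proof.
have [w bw hw] := mom1_approx.
(* With k = 1 the recurrence has constant part S_2(b)/b^3 + 2 v_1 S_1(b)/b^3;
   the remainder below is b^5 times what is left of it after subtracting
   c (1 - b^-2 (1 - 1/b)). *)
apply: (@mom_approx 1 5 _ (fun b => - (1 / 3) + 5 / 6 * b%:R^-1 + b%:R^-1 * (1 - b%:R^-1) * w b)).
  bnd_tac.
move=> b b2 t; rewrite !big_ord_recr big_ord0/= !binE mom0// hw// scaled_sum1// scaled_sum2// -/t.
by field.
Qed.

Lemma mom3_approx : exists2 w, bnd w & forall b, (2 <= b)%N ->
  let t := b%:R^-1 in mom R b 3 = 1 / 4 + t ^+ 3 * w b.
Proof.
have [w bw hw] := mom1_approx; have [u bu hu] := mom2_approx.
(* v_1 = 1/2 + a1/b^2 and v_2 = 1/3 + a2/b^3 with a1, a2 bounded. *)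
pose a1 b : R := - (1 / 2) - b%:R^-1 / 2 + b%:R^-1 ^+ 3 * w b.
pose a2 b : R := - (5 / 6) + b%:R^-1 ^+ 2 * u b.
apply: (@mom_approx 2 3 _ (fun b => 1 / 4 - 1 / 2 + (2 - 3 * b%:R^-1 + b%:R^-1 ^+ 2) / 2 * a1 b
   + 3 / 2 * b%:R^-1 ^+ 2 * (1 - b%:R^-1) * a2 b + (1 - b%:R^-1) / 4)).
  rewrite /a1 /a2; bnd_tac.
move=> b b2 t; rewrite !big_ord_recr big_ord0/= !binE mom0// hw// hu//.
rewrite scaled_sum1// scaled_sum2// scaled_sum3// -/t /a1 /a2 -/t.
by field.
Qed.

Lemma mom4_approx : exists2 w, bnd w & forall b, (2 <= b)%N ->
  let t := b%:R^-1 in mom R b 4 = 1 / 5 + t ^+ 2 * w b.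
Proof.
have [w bw hw] := mom1_approx.
(* v_1 = 1/2 + a1/b^2; for v_2 and v_3 boundedness is enough. *)
pose a1 b : R := - (1 / 2) - b%:R^-1 / 2 + b%:R^-1 ^+ 3 * w b.
apply: (@mom_approx 3 2 _ (fun b => - (2 / 3) + b%:R^-1 / 2 - b%:R^-1 ^+ 2 / 30
   + b%:R^-1 * (1 - b%:R^-1) ^+ 2 * a1 b
   + (2 - 3 * b%:R^-1 + b%:R^-1 ^+ 2) * mom R b 2
   + 2 * b%:R^-1 * (1 - b%:R^-1) * mom R b 3 + b%:R^-1 ^+ 2 * (1 - b%:R^-1) / 5)).
  rewrite /a1; bnd_tac.
move=> b b2 t; rewrite !big_ord_recr big_ord0/= !binE mom0// hw//.
rewrite scaled_sum1// scaled_sum2// scaled_sum3// scaled_sum4// -/t /a1 -/t.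
by field.
Qed.

Lemma mom5_approx : exists2 w, bnd w & forall b, (2 <= b)%N ->
  let t := b%:R^-1 in mom R b 5 = 1 / 6 + t ^+ 1 * w b.
Proof.
apply: (@mom_approx 4 1 _ (fun b => - (1 / 2) + 5 / 12 * b%:R^-1 - b%:R^-1 ^+ 3 / 12
   + 5 * (1 / 5 - b%:R^-1 / 2 + b%:R^-1 ^+ 2 / 3 - b%:R^-1 ^+ 4 / 30) * mom R b 1
   + 10 * b%:R^-1 * ((1 - b%:R^-1) ^+ 2 / 4) * mom R b 2
   + 10 * b%:R^-1 ^+ 2 * ((1 - b%:R^-1) * (2 - b%:R^-1) / 6) * mom R b 3
   + 5 * b%:R^-1 ^+ 3 * ((1 - b%:R^-1) / 2) * mom R b 4
   + b%:R^-1 ^+ 4 * (1 - b%:R^-1) / 6)).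
  bnd_tac.
move=> b b2 t; rewrite !big_ord_recr big_ord0/= !binE mom0//.
rewrite scaled_sum1// scaled_sum2// scaled_sum3// scaled_sum4// scaled_sum5// -/t.
by field.
Qed.

End Coefficients.

(** * Expansions up to the sixth order *)

Section FinalExpansions.
Variable R : realType.

Lemma K_expansion6 : exists C : R, forall b : nat, (2 <= b)%N ->
  `|K b 0 - (b%:R * ln b%:R + zeta 2 / (2 * b%:R) - zeta 3 / (3 * b%:R ^+ 2)
           - (2 * zeta 2 - zeta 4) / (4 * b%:R ^+ 3)
           - (5 * zeta 2 / 2 + zeta 5) / (5 * b%:R ^+ 4)
           + (5 * zeta 3 + zeta 6) / (6 * b%:R ^+ 5))| <= C * b%:R ^- 6.
Proof.
have [w1 b1 h1] := mom1_approx R; have [w2 b2' h2] := mom2_approx R.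
have [w3 b3 h3] := mom3_approx R; have [w4 b4 h4] := mom4_approx R.
have [w5 b5 h5] := mom5_approx R.
have bz (z2 z3 z4 z5 z6 : R) :
    bnd (fun b => z2 * w1 b - z3 * b%:R^-1 * w2 b + z4 * w3 b - z5 * w4 b + z6 * w5 b).
  by bnd_tac.
have [C hC] := bz (zeta 2) (zeta 3) (zeta 4) (zeta 5) (zeta 6).
exists (2 + C) => b b2; have bn0 : b%:R != 0 :> R by rewrite pnatr_eq0 -lt0n ltnW.
have := @K_expansion R b b2 5.
rewrite !big_ord_recr big_ord0/= h1// h2// h3// h4// h5// => hK.
set s := (X in `|_ - X| <= _) in hK.
set g := (X in `|_ - X| <= _).
have e : K b 0 - g = (K b 0 - b%:R * ln b%:R - s) + b%:R ^- 6 *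
   (zeta 2 * w1 b - zeta 3 * b%:R^-1 * w2 b + zeta 4 * w3 b - zeta 5 * w4 b + zeta 6 * w5 b).
  rewrite /g /s; field.
  done.
rewrite e (le_trans (ler_normD _ _))// mulrDl lerD// normrM mulrC.
have p0 : 0 <= b%:R ^- 6 :> R by rewrite invr_ge0 exprn_ge0.
by rewrite (ger0_norm p0) ler_wpM2r// hC.
Qed.

Lemma ln_Gamma_expansion6 : exists C : R, forall b : nat, (2 <= b)%N ->
  `|(b%:R * ln b%:R + zeta 2 / (2 * b%:R) - zeta 3 / (3 * b%:R ^+ 2)
           - (2 * zeta 2 - zeta 4) / (4 * b%:R ^+ 3)
           - (5 * zeta 2 / 2 + zeta 5) / (5 * b%:R ^+ 4)
           + (5 * zeta 3 + zeta 6) / (6 * b%:R ^+ 5))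
    - (b%:R * ln b%:R + b%:R * ln (Gamma (1 + b%:R^-1)) - digamma 1
           - zeta 2 / (2 * b%:R * (b%:R ^+ 2 - b%:R + 1))
           + 5 * zeta 3 / (6 * b%:R ^+ 5))| <= C * b%:R ^- 6.
Proof.
exists (4 + `|zeta 2|) => b b2.
have bn0 : b%:R != 0 :> R by rewrite pnatr_eq0 -lt0n ltnW.
have b0 : 0 < b%:R :> R by rewrite ltr0n ltnW.
have /andP[t0 t1] := invn_itv R b2.
have tn : `|b%:R^-1| <= 2^-1 :> R by rewrite gtr0_norm.
have hL := ln_Gamma1D_taylor 5 tn.
rewrite !big_ord_recr big_ord0/= [`|b%:R^-1|]gtr0_norm// in hL.
rewrite digamma1; set L := ln (Gamma _) in hL *; set s := (X in `|_ - X| <= _) in hL.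
set d : R := b%:R ^+ 2 - b%:R + 1.
have d1 : 1 <= d.
  have : 1 <= b%:R :> R by rewrite ler1n ltnW.
  by rewrite /d; nra.
have dn0 : d != 0 by rewrite gt_eqF// (lt_le_trans ltr01).
set lhs := (X in `|X| <= _).
(* 1/(b d) = b^-3 + b^-4 - b^-6 (b^2/d), where d = b^2 - b + 1. *)
have e : lhs = - (b%:R * (L + euler_gamma R * b%:R^-1 - s)) - b%:R ^- 6 * (zeta 2 / 2 * (b%:R ^+ 2 / d)).
  rewrite /lhs /s /d. field.
  by rewrite -/d dn0 bn0.
rewrite e (le_trans (ler_normB _ _))// normrN mulrDl lerD//.
  rewrite normrM gtr0_norm//.
  apply: (@le_trans _ _ (b%:R * (4 * b%:R^-1 ^+ 7))); first by rewrite ler_wpM2l// ltW.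
  by rewrite mulrCA exprS mulVKf// exprVn.
have p0 : 0 <= b%:R ^- 6 :> R by rewrite invr_ge0 exprn_ge0.
have q0 : 0 <= b%:R ^+ 2 / d :> R by rewrite divr_ge0 ?exprn_ge0// (le_trans ler01).
rewrite normrM (ger0_norm p0) mulrC ler_wpM2r// normrM normrM -mulrA ler_piMr//.
rewrite normfV (ger0_norm (ler0n _ 2)) (ger0_norm q0).
rewrite mulrA ler_pdivrMr ?(lt_le_trans ltr01)// mul1r mulrC ler_pdivrMr//.
have := sqr_ge0 ((b%:R : R) - 1); rewrite /d; nra.
Qed.

End FinalExpansions.

Theorem proposition7 (R : realType) :
  [/\ exists a : nat -> R,
        asymptotic_expansion_inv (fun b => K b 0 - b%:R * ln b%:R) a,
      eq_upto_inv_pow 6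
        (fun b => K b 0 : R)
        (fun b =>
           b%:R * ln b%:R + b%:R * ln (Gamma (1 + b%:R^-1)) - digamma 1
           - zeta 2 / (2 * b%:R * (b%:R ^+ 2 - b%:R + 1))
           + 5 * zeta 3 / (6 * b%:R ^+ 5))
    & eq_upto_inv_pow 6
        (fun b => K b 0 : R)
        (fun b =>
           b%:R * ln b%:R + zeta 2 / (2 * b%:R) - zeta 3 / (3 * b%:R ^+ 2)
           - (2 * zeta 2 - zeta 4) / (4 * b%:R ^+ 3)
           - (5 * zeta 2 / 2 + zeta 5) / (5 * b%:R ^+ 4)
           + (5 * zeta 3 + zeta 6) / (6 * b%:R ^+ 5))].
Proof.
have [C1 h1] := K_expansion6 R; have [C2 h2] := ln_Gamma_expansion6 R.
split.
- exact: expandable_expansion (expandable_K R).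
- apply: (@eq_upto_bound _ _ _ _ (C1 + C2)) => b b2.
  rewrite [leRHS]mulrDl /=; apply: le_trans (lerD (h1 b b2) (h2 b b2)); exact: ler_distD.
- exact: eq_upto_bound h1.
Qed.
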